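(* Let $\mu_1,\mu_2,\ldots$ be i.i.d. with prior density $g$ on $(0,\infty)$ satisfying $g(\mu)\sim\alpha\mu^{\beta-1}$ as $\mu\to0$ for some $\alpha>0,\beta>0$, and let $\lambda>0$. Consider idealized empirical CBT: arms $k=1,2,\ldots$ are examined in turn (each revealing its mean $\mu_k$); experimentation stops after $$K=\inf\Big\{k\ge1:\min_{1\le i\le k}\mu_i\le\tfrac{k\lambda}{n}\Big\}$$ arms, after which the arm with the smallest mean $\min_{1\le k\le K}\mu_k$ is played $n$ additional times. Define its regret as $R_n=\lambda EK+nE\big(\min_{1\le k\le K}\mu_k\big)$. Then as $n\to\infty$, $$R_n\sim CI_\beta n^{\frac\beta{\beta+1}},$$ where $C=\big(\frac{\lambda\beta(\beta+1)}{\alpha}\big)^{\frac1{\beta+1}}$ and $I_\beta=\big(\frac1{\beta+1}\big)^{\frac1{\beta+1}}\big(2-\frac1{(\beta+1)^2}\big)\Gamma\big(2-\frac\beta{\beta+1}\big)$, with $\Gamma(u)=\int_0^\infty x^{u-1}e^{-x}dx$.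
   Context: In the paper, $\lambda=\int_0^\infty E_\mu(X\mid X>0)g(\mu)\,d\mu$ is the mean of the first non-zero reward of a random arm, interpreted as the cost of experimenting with a new arm (each arm is played until its first non-zero reward, when its mean is revealed). $a_n\sim b_n$ means $a_n/b_n\to1$. *)

(* Defs.v *)
From HB Require Import structures.
From mathcomp Require Import all_boot all_order all_algebra.
From mathcomp Require Import all_classical all_reals all_analysis.
Set Implicit Arguments. Unset Strict Implicit. Unset Printing Implicit Defensive.
Import Order.TTheory GRing.Theory Num.Theory.
Import numFieldNormedType.Exports.
Local Open Scope classical_set_scope.
Local Open Scope ring_scope.

Definition mutually_independent {d} {T : measurableType d} {R : realType}
  (P : probability T R) (X : nat -> T -> R) : Prop :=
  forall (I : seq nat) (A : nat -> set R), uniq I ->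
    (forall i, i \in I -> measurable (A i)) ->
    P (\bigcap_(i in [set` I]) (X i @^-1` A i)) =
    (\prod_(i <- I) P (X i @^-1` A i))%E.

Definition Gamma {R : realType} (u : R) : R :=
  fine (\int[@lebesgue_measure R]_(x in `]0%R, +oo[)
          ((x `^ (u - 1)) * expR (- x))%:E)%E.

(* running minimum  min_{1 <= i <= k} mu_i  (arms indexed from 0 here:
   arm number i+1 has mean mu i); meaningful for k >= 1. *)
Definition runmin {T : Type} {R : realType} (mu : nat -> T -> R) (k : nat) (w : T) : R :=
  \big[Order.min/mu 0%N w]_(i < k) mu i w.

Definition stops {T : Type} {R : realType} (mu : nat -> T -> R) (lam : R) (n : nat)
  (w : T) : pred nat :=
  fun k => (0 < k)%N && (runmin mu k w <= k%:R * lam / n%:R).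

(* K = inf { k >= 1 : min_{i<=k} mu_i <= k lambda / n }  (0 if the set is empty,
   which never happens since mu_1 is a real number). *)
Definition Kstop {T : Type} {R : realType} (mu : nat -> T -> R) (lam : R) (n : nat)
  (w : T) : nat :=
  match pselect (exists k, stops mu lam n w k) with
  | left h => ex_minn h
  | right _ => 0%N
  end.

Definition regret {d} {T : measurableType d} {R : realType} (P : probability T R)
  (mu : nat -> T -> R) (lam : R) (n : nat) : \bar R :=
  (lam%:E * (\int[P]_w ((Kstop mu lam n w)%:R)%:E)
   + n%:R%:E * (\int[P]_w (runmin mu (Kstop mu lam n w) w)%:E))%E.

(* Main.v *)
(* Write [F] for the distribution function of the arms and [c_k = k lam / n].
   Since the stopping level increases, [K > k] means that the first [k] means
   all exceed [c_k], so [E K = S] with [S = sum_k (1 - F c_k)^k].  If [M] is the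
   final minimum, the number of [j < K] with [M <= c_j] is [K - n M / lam] up to
   an error in [[0, 1]].  These [j] satisfy [c_j < c_K], so they come from the
   last arm only, and independence gives the expectation
   [N = sum_k (1 - F c_k)^k * sum_(j <= k) F c_j] of their number.  Hence
   [lam (2 S - N - 1) <= R_n <= lam (2 S - N)].

   As [F x ~ (alpha / beta) x^beta], rescaling [k = m t] with [m] of order
   [n^(beta / (beta + 1))] and dominated convergence give, with [p = beta + 1],
   [S / m -> int_0^oo exp (- t^p) dt = Gamma (1 + 1/p)] and
   [N / m -> (1/p) int_0^oo t^p exp (- t^p) dt = Gamma (1 + 1/p) / p^2],
   which produces the constant [2 - 1/p^2]. *)

Require Import Defs.
From HB Require Import structures.
From mathcomp Require Import all_boot all_order all_algebra.
From mathcomp Require Import all_classical all_reals all_analysis.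
From mathcomp Require Import measurable_realfun ring lra.
Import Order.TTheory GRing.Theory Num.Theory.
Import numFieldNormedType.Exports.
Local Open Scope classical_set_scope.
Local Open Scope ring_scope.

(** * Power and Gamma integrals *)

Lemma continuous_powR (R : realType) (p x : R) :
  0 < x -> {for x, continuous (fun y : R => y `^ p)}.
Proof.
move=> x0; apply: differentiable_continuous; apply/derivable1_diffP.
by apply: derivable_powR; rewrite in_itv/= andbT.
Qed.

Lemma pos_continuous_FTC2 (R : realType) (f F : R -> R) (a b : R) :
  0 < a -> a < b ->
  (forall x : R, 0 < x -> {for x, continuous f}) ->
  (forall x : R, 0 < x -> is_derive x 1 F (f x)) ->
  (\int[lebesgue_measure]_(x in `[a, b]) (f x)%:E = (F b - F a)%:E)%E.
Proof.
move=> a0 ab cf dF.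
have cF x : 0 < x -> {for x, continuous F}.
  move=> /dF dFx; apply: differentiable_continuous; apply/derivable1_diffP.
  exact: ex_derive.
rewrite (@continuous_FTC2 _ f F)//.
- apply: continuous_in_subspaceT => x; rewrite inE/= in_itv/= => /andP[ax _].
  exact: cf (lt_le_trans a0 ax).
- split.
  + move=> x; rewrite in_itv/= => /andP[ax _].
    exact: (@ex_derive _ _ _ _ _ _ _ (dF _ (lt_trans a0 ax))).
  + exact/cvg_at_right_filter/cF.
  + exact/cvg_at_left_filter/cF/(lt_trans a0).
- move=> x; rewrite in_itv/= => /andP[ax _].
  by rewrite derive1E; apply: derive_val; exact: dF (lt_trans a0 ax).
Qed.

(** For [b < 1] the integrand is unbounded at 0, so [x^b / b] is used as a primitive only on
    [[y / (n + 2), y]]; monotone convergence on the left and continuity of [x^b] at 0 on the right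
    then give the two limits. *)
Lemma integral_powRB1 (R : realType) (b y : R) : 0 < b -> 0 < y ->
  (\int[lebesgue_measure]_(x in `]0%R, y]) (x `^ (b - 1))%:E = (y `^ b / b)%:E)%E.
Proof.
move=> b0 y0.
pose a n : R := y / n.+2%:R.
have a0 n : 0 < a n by rewrite divr_gt0.
have ay n : a n < y.
  by rewrite /a ltr_pdivrMr// ltr_pMr// ltr1n.
have aE : \bigcup_n `[a n, y]%classic = `]0%R, y]%classic.
  apply/seteqP; split => [x [n _]|x]/=; rewrite !in_itv/=.
    by move=> /andP[ax ->]; rewrite (lt_le_trans (a0 n) ax).
  move=> /andP[x0 xy]; exists (Num.truncn (y / x)) => //=.
  rewrite in_itv/= xy andbT /a ler_pdivrMr// mulrC -ler_pdivrMr//.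
  by rewrite (le_trans (ltW (truncnS_gt _)))// ler_nat.
have cI : (\int[lebesgue_measure]_(x in `[a n, y]) (x `^ (b - 1))%:E)%E @[n --> \oo] -->
          (\int[lebesgue_measure]_(x in `]0%R, y]) (x `^ (b - 1))%:E)%E.
  rewrite -aE; apply: ge0_nondecreasing_set_cvg_integral => //.
  - move=> i j ij; apply/subsetPset; apply: subset_itvr; rewrite bnd_simp /a.
    by rewrite ler_pM2l// lef_pV2 ?posrE// ler_nat.
  - move=> i; apply/measurable_EFinP; apply: measurable_funTS.
    exact: measurable_powR.
  - by move=> i x _; rewrite lee_fin powR_ge0.
have IE n : (\int[lebesgue_measure]_(x in `[a n, y]) (x `^ (b - 1))%:E)%E =
    (y `^ b / b - (a n) `^ b / b)%:E.
  apply: (@pos_continuous_FTC2 _ _ (fun x => x `^ b * b^-1)) => //.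
  - by move=> x x0; exact: continuous_powR.
  - move=> x x0; have h := @is_derive1_powR _ b x x0.
    apply: is_derive_eq; rewrite scaler0 add0r.
    by rewrite /GRing.scale/= mulrA mulVf ?mul1r// gt_eqF.
have cR : (\int[lebesgue_measure]_(x in `[a n, y]) (x `^ (b - 1))%:E)%E @[n --> \oo] -->
    (y `^ b / b - 0 / b)%:E.
  under eq_cvg do rewrite IE.
  apply: cvg_EFin; first exact: nearW.
  apply: cvgB; first exact: cvg_cst.
  apply: cvgMr_tmp.
  have := @powR_cvg0 R b b0; rewrite (cvg_at_rightP _ _ _) => /(_ a); apply.
  split => //.
  rewrite -(mulr0 y); apply: cvgMl_tmp.
  by have := @cvg_harmonic R; rewrite -(cvg_shiftS (@harmonic R)).
rewrite mul0r subr0 in cR.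
by apply: (cvg_unique _ cI cR).
Qed.

Lemma is_derive_expRN_powR (R : realType) (p x : R) : 0 < x ->
  is_derive x 1 (fun t : R => expR (- t `^ p))
    (- (p * x `^ (p - 1)) * expR (- x `^ p)).
Proof.
move=> x0.
have h := @is_derive1_powR _ p x x0.
have h1 := @is_deriveN _ _ _ _ _ _ _ h.
have h2 := is_derive_expR (- x `^ p).
have := @is_derive1_comp R expR (fun t => - t `^ p) x _ _ _ h1.
by rewrite [in X in _ -> X]mulrC => /(_ _ h2).
Qed.

(** Monotone convergence along an exhaustion by compact intervals. It lets integration by parts and
    substitution be carried out away from 0 and infinity. *)
Lemma ge0_cvg_integral_itv0y (R : realType) (f : R -> R) (a b : nat -> R) :
  measurable_fun setT f -> (forall x, 0 <= f x) ->
  (forall n, 0 < a n) -> {homo a : m n / (m <= n)%N >-> n <= m} ->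
  {homo b : m n / (m <= n)%N >-> m <= n} ->
  (forall x, 0 < x -> exists n, a n <= x <= b n) ->
  (\int[lebesgue_measure]_(x in `[a n, b n]) (f x)%:E)%E @[n --> \oo] -->
  (\int[lebesgue_measure]_(x in `]0%R, +oo[) (f x)%:E)%E.
Proof.
move=> mf f0 a0 adecr bincr abx.
have -> : `]0%R, +oo[%classic = \bigcup_n `[a n, b n]%classic :> set R.
  apply/seteqP; split => [x|x [n _]]/=; rewrite !in_itv/=.
    by rewrite andbT => /abx[n axb]; exists n => //=; rewrite in_itv.
  by move=> /andP[ax _]; rewrite (lt_le_trans (a0 n) ax).
apply: ge0_nondecreasing_set_cvg_integral => //.
- move=> i j ij; apply/subsetPset; apply: subset_itv; rewrite bnd_simp.
    exact: adecr.
  exact: bincr.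
- by move=> i; apply/measurable_EFinP; exact: measurable_funTS.
- by move=> i x _; rewrite lee_fin.
Qed.

Lemma ler_natV_exhaustion (R : realType) (x : R) : 0 < x ->
  exists n, n.+2%:R^-1 <= x <= n.+2%:R.
Proof.
move=> x0; exists (maxn (Num.truncn x) (Num.truncn x^-1)).
apply/andP; split.
  rewrite -[leRHS]invrK lef_pV2 ?posrE ?invr_gt0//.
  rewrite (le_trans (ltW (truncnS_gt _)))// ler_nat.
  by rewrite (@leq_trans (maxn (Num.truncn x) (Num.truncn x^-1)).+1)// ltnS leq_maxr.
rewrite (le_trans (ltW (truncnS_gt _)))// ler_nat.
by rewrite (@leq_trans (maxn (Num.truncn x) (Num.truncn x^-1)).+1)// ltnS leq_maxl.
Qed.

(* [t * exp (- t^p)] vanishes at both ends of [(0, oo)]; its derivative is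
   [exp (- t^p) - p t^p exp (- t^p)]. *)
Lemma integral_expRN_powR (R : realType) (p : R) : 1 <= p ->
  (\int[lebesgue_measure]_(t in `]0%R, +oo[) (expR (- t `^ p))%:E =
   p%:E * \int[lebesgue_measure]_(t in `]0%R, +oo[) (t `^ p * expR (- t `^ p))%:E)%E.
Proof.
move=> p1; have p0 : 0 < p by exact: lt_le_trans p1.
pose a n : R := n.+2%:R^-1; pose b n : R := n.+2%:R.
have a0 n : 0 < a n by rewrite invr_gt0.
have ab n : a n < b n.
  by rewrite (@lt_trans _ _ 1)// ?invf_lt1// ltr1n.
have cI (f : R -> R) : measurable_fun setT f -> (forall x, 0 <= f x) ->
    (\int[lebesgue_measure]_(x in `[a n, b n]) (f x)%:E)%E @[n --> \oo] -->
    (\int[lebesgue_measure]_(x in `]0%R, +oo[) (f x)%:E)%E.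
  move=> mf f0; apply: ge0_cvg_integral_itv0y => //.
  - by move=> m n mn; rewrite lef_pV2 ?posrE// ler_nat.
  - by move=> m n mn; rewrite ler_nat.
  - exact: ler_natV_exhaustion.
have mpow : measurable_fun setT (fun x : R => x `^ p) by exact: measurable_powR.
have mexp : measurable_fun setT (fun x : R => expR (- x `^ p)).
  by apply: measurableT_comp => //; exact: measurableT_comp.
have mpe : measurable_fun setT (fun x : R => x `^ p * expR (- x `^ p)).
  exact: measurable_funM.
have cA := cI _ mexp (fun x => expR_ge0 _).
have cB := cI _ mpe (fun x => mulr_ge0 (powR_ge0 _ _) (expR_ge0 _)).
set A := (X in _ --> X) in cA; set B := (X in _ --> X) in cB.
have cpow (x : R) : 0 < x -> {for x, continuous (fun t : R => t `^ p)}.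
  exact: continuous_powR.
have cexp (x : R) : 0 < x -> {for x, continuous (fun t : R => expR (- t `^ p))}.
  move=> x0; apply: differentiable_continuous; apply/derivable1_diffP.
  exact: (@ex_derive _ _ _ _ _ _ _ (is_derive_expRN_powR R p x x0)).
pose G (t : R) := t * expR (- t `^ p).
pose f (t : R) := expR (- t `^ p).
pose g (t : R) := p * (t `^ p * expR (- t `^ p)).
have cf (x : R) : 0 < x -> {for x, continuous f} by exact: cexp.
have cg (x : R) : 0 < x -> {for x, continuous g}.
  move=> x0; apply: cvgMl_tmp; apply: cvgM; [exact: cpow|exact: cexp].
(* The product rule gives [G' = f - g], once [x^p] is split as [x * x^(p - 1)]. *)
have dG (x : R) : 0 < x -> is_derive x 1 G (f x - g x).
  move=> x0; have h := is_derive_expRN_powR R p x x0.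
  apply: is_derive_eq; rewrite /GRing.scale/= mulr1 addrC; congr (_ + _).
  rewrite /g; set E := expR _; rewrite -(mulr_powRB1 (ltW x0) p0); ring.
have intI (h : R -> R) n : (forall x : R, 0 < x -> {for x, continuous h}) ->
    lebesgue_measure.-integrable `[a n, b n] (EFin \o h).
  move=> ch; apply: continuous_compact_integrable; first exact: segment_compact.
  apply: continuous_in_subspaceT => x; rewrite inE/= in_itv/= => /andP[ax _].
  exact: ch (lt_le_trans (a0 n) ax).
have FTC n : (\int[lebesgue_measure]_(x in `[a n, b n]) (f x)%:E =
   (G (b n) - G (a n))%:E + p%:E *
   \int[lebesgue_measure]_(x in `[a n, b n]) (x `^ p * expR (- x `^ p))%:E)%E.
  rewrite -(@pos_continuous_FTC2 _ (fun x => f x - g x) G)//; last first.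
    by move=> x x0; apply: cvgB; [exact: cf|exact: cg].
  rewrite -integralZl//; last first.
    by apply: intI => x x0; apply: cvgM; [exact: cpow|exact: cexp].
  under [X in (_ = X + _)%E]eq_integral do rewrite EFinB.
  rewrite integralB//; [|exact: intI|exact: intI].
  rewrite subeK//.
  by apply: integrable_fin_num => //; exact: intI.
have ca : a n @[n --> \oo] --> (0 : R).
  by have := @cvg_harmonic R; rewrite -(cvg_shiftS (@harmonic R)).
(* As [b n >= 1] and [p >= 1], [exp (b^p) >= exp b >= 1 + b^2 / 2], hence [G b <= 2 / b], which is
   [2 * a n]. *)
have Gb : G (b n) @[n --> \oo] --> 0.
  apply: (@squeeze_cvgr _ _ _ _ (cst 0) (fun n => 2 * a n)); last 2 first.
  - exact: cvg_cst.
  - by rewrite -(mulr0 2); exact: cvgMl_tmp.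
  apply: nearW => n /=; rewrite mulr_ge0 ?expR_ge0//=.
  have b1 : 1 <= b n by rewrite ler1n.
  have b0 : 0 < b n by [].
  rewrite /G expRN ler_pdivrMr ?expR_gt0//.
  have : 1 + b n ^+ 2 / 2 <= expR (b n `^ p).
    rewrite (le_trans (expR_ge1Dxn 1 (ltW b0)))// ler_expR.
    exact: le1r_powR.
  move=> h; apply: (@le_trans _ _ (2 * a n * (b n ^+ 2 / 2))).
    rewrite /a -/(b n) [leRHS](_ : _ = b n)//.
    by field; rewrite gt_eqF.
  by rewrite ler_pM2l ?mulr_gt0// (le_trans _ h)// lerDr.
have Ga : G (a n) @[n --> \oo] --> 0.
  apply: (@squeeze_cvgr _ _ _ _ (cst 0) a) => //; last exact: cvg_cst.
  apply: nearW => n /=; rewrite mulr_ge0 ?expR_ge0 ?(ltW (a0 n))//=.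
  by rewrite /G ler_piMr ?(ltW (a0 n))// expR_le1 oppr_le0 powR_ge0.
have cA' : (\int[lebesgue_measure]_(x in `[a n, b n]) (f x)%:E)%E @[n --> \oo]
    --> (0%:E + p%:E * B)%E.
  under eq_cvg do rewrite FTC.
  apply: cvgeD; first by rewrite fin_num_adde_defr.
    apply: cvg_EFin; first exact: nearW.
    by rewrite -(subr0 0); apply: cvgB.
  exact: cvgeZl.
have E := cvg_unique (@ereal_hausdorff R) cA cA'; rewrite add0e in E; exact: E.
Qed.

(** Substitution [u = t^p], made on [[a n, b n]] and passed to the limit: [u^(1/p) exp (- u) du]
    becomes [t * exp (- t^p) * p t^(p - 1) dt]. *)
Lemma integral_Gamma_powR (R : realType) (p : R) : 0 < p ->
  (\int[lebesgue_measure]_(u in `]0%R, +oo[) (u `^ p^-1 * expR (- u))%:E =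
   p%:E * \int[lebesgue_measure]_(t in `]0%R, +oo[) (t `^ p * expR (- t `^ p))%:E)%E.
Proof.
move=> p0.
pose a n : R := n.+2%:R^-1; pose b n : R := n.+2%:R.
have a0 n : 0 < a n by rewrite invr_gt0.
have ab n : a n < b n.
  by rewrite (@lt_trans _ _ 1)// ?invf_lt1// ltr1n.
have adecr : {homo a : m n / (m <= n)%N >-> n <= m}.
  by move=> m n mn; rewrite lef_pV2 ?posrE// ler_nat.
have bincr : {homo b : m n / (m <= n)%N >-> m <= n}.
  by move=> m n mn; rewrite ler_nat.
have mpow q : measurable_fun setT (fun x : R => x `^ q) by exact: measurable_powR.
have cB : (\int[lebesgue_measure]_(t in `[a n, b n]) (p * (t `^ p * expR (- t `^ p)))%:E)%E
    @[n --> \oo] -->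
    (\int[lebesgue_measure]_(t in `]0%R, +oo[) (p * (t `^ p * expR (- t `^ p)))%:E)%E.
  apply: ge0_cvg_integral_itv0y => //.
  - apply: measurable_funM => //; apply: measurable_funM => //.
    by apply: measurableT_comp => //; exact: measurableT_comp.
  - by move=> x; rewrite !mulr_ge0 ?powR_ge0 ?expR_ge0// ltW.
  - exact: ler_natV_exhaustion.
have cA : (\int[lebesgue_measure]_(u in `[(a n `^ p)%R, (b n `^ p)%R]) (u `^ p^-1 * expR (- u))%:E)%E
    @[n --> \oo] -->
    (\int[lebesgue_measure]_(u in `]0%R, +oo[) (u `^ p^-1 * expR (- u))%:E)%E.
  apply: (@ge0_cvg_integral_itv0y R (fun u => u `^ p^-1 * expR (- u))
    (fun n => a n `^ p) (fun n => b n `^ p)) => //.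
  - by apply: measurable_funM => //; apply: measurableT_comp => //; exact: measurableT_comp.
  - by move=> x; rewrite mulr_ge0 ?powR_ge0 ?expR_ge0.
  - by move=> n; rewrite powR_gt0.
  - by move=> m n mn; apply: ge0_ler_powR; rewrite ?nnegrE ?(ltW p0) ?(ltW (a0 _))// adecr.
  - by move=> m n mn; apply: ge0_ler_powR; rewrite ?nnegrE ?(ltW p0)// bincr.
  - move=> x x0; have [n /andP[an bn]] := ler_natV_exhaustion R _ (powR_gt0 p^-1 x0).
    exists n; rewrite -[x](powRr1 (ltW x0)) -(@mulVf _ p) ?gt_eqF// powRrM.
    by apply/andP; split; apply: ge0_ler_powR; rewrite ?nnegrE ?powR_ge0 ?(ltW p0) ?(ltW (a0 _)).
have ABn n : (\int[lebesgue_measure]_(u in `[(a n `^ p)%R, (b n `^ p)%R]) (u `^ p^-1 * expR (- u))%:E =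
    \int[lebesgue_measure]_(t in `[a n, b n]) (p * (t `^ p * expR (- t `^ p)))%:E)%E.
  have d1E (x : R) : 0 < x -> (fun y : R => y `^ p)^`()%classic x = p * x `^ (p - 1).
    by move=> x0; rewrite powR_derive1// in_itv/= andbT.
  have cd (x : R) : 0 < x -> {for x, continuous ((fun y : R => y `^ p)^`()%classic)}.
    move=> x0; rewrite /prop_for /continuous_at d1E//.
    have c : {for x, continuous (fun y => p * y `^ (p - 1))}.
      by apply: cvgMl_tmp; exact: continuous_powR.
    apply: (@cvg_trans _ ((p * y `^ (p - 1)) @[y --> x])).
      apply: near_eq_cvg; near=> y; rewrite d1E//.
      by near: y; exact: lt_nbhsr.
    exact: c.
  rewrite (@integration_by_substitution_increasing R (fun x => x `^ p)
    (fun u => u `^ p^-1 * expR (- u)) (a n) (b n)).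
  - apply: eq_integral => x; rewrite inE/= in_itv/= => /andP[ax _].
    have x0 := lt_le_trans (a0 n) ax.
    congr EFin; rewrite !fctE d1E// -powRrM mulfV ?gt_eqF// powRr1 ?ltW//.
    set E := expR _; rewrite -(mulr_powRB1 (ltW x0) p0); ring.
  - exact: ltW.
  - move=> x y; rewrite !in_itv/= => /andP[ax _] /andP[ay _] xy.
    by rewrite gt0_ltr_powR// nnegrE ltW// (lt_le_trans (a0 n)).
  - move=> x; rewrite in_itv/= => /andP[ax _].
    by apply: cd; rewrite (lt_trans (a0 n)).
  - by apply/cvg_ex; eexists; apply/cvg_at_right_filter; exact: cd.
  - apply/cvg_ex; eexists; apply/cvg_at_left_filter; apply: cd.
    exact: lt_trans (ab n).
  - split.
    + move=> x; rewrite in_itv/= => /andP[ax _].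
      by apply: derivable_powR; rewrite in_itv/= andbT (lt_trans (a0 n)).
    + exact/cvg_at_right_filter/continuous_powR.
    + exact/cvg_at_left_filter/continuous_powR/(lt_trans (a0 n)).
  - apply: continuous_in_subspaceT => x; rewrite inE/= in_itv/= => /andP[ax _].
    apply: cvgM; first by apply: continuous_powR; rewrite (lt_le_trans _ ax)// powR_gt0.
    by apply: continuous_comp; [exact: continuousN|exact: continuous_expR].
have {}cA : (\int[lebesgue_measure]_(t in `[a n, b n]) (p * (t `^ p * expR (- t `^ p)))%:E)%E
    @[n --> \oo] -->
    (\int[lebesgue_measure]_(u in `]0%R, +oo[) (u `^ p^-1 * expR (- u))%:E)%E.
  by move: cA; under eq_cvg do rewrite ABn.
have E := cvg_unique (@ereal_hausdorff R) cA cB.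
rewrite E -ge0_integralZl//.
- apply/measurable_EFinP; apply: measurable_funTS; apply: measurable_funM => //.
  by apply: measurableT_comp => //; exact: measurableT_comp.
- by move=> x _; rewrite lee_fin mulr_ge0 ?powR_ge0 ?expR_ge0.
- by rewrite lee_fin ltW.
Unshelve. all: by end_near. Qed.

Lemma integrable_expRNM (R : realType) (c : R) : 0 < c ->
  lebesgue_measure.-integrable (`]0%R, +oo[ : set R) (fun t => (expR (- (c * t)))%:E).
Proof.
move=> c0.
have h : lebesgue_measure.-integrable (`]0%R, +oo[ : set R)
    (fun t => (c^-1)%:E * (exponential_pdf c t)%:E)%E.
  apply: integrableZl => //; apply: integrableS (integrable_exponential_pdf c0) => //.
apply: eq_integrable h => // t; rewrite inE/= in_itv/= andbT => t0.
rewrite exponential_pdfE ?ltW// -EFinM mulrA mulVf ?gt_eqF// mul1r.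
by rewrite mulNr.
Qed.

(** The integration by parts and the substitution both produce [p] times the integral of
    [t^p exp (- t^p)], so the integral of [exp (- t^p)] is the Gamma integral at [1 + 1/p].
    Finiteness has to come first, because [Gamma] is defined through [fine]. *)
Lemma GammaE (R : realType) (p : R) : 1 <= p ->
  (\int[lebesgue_measure]_(t in `]0%R, +oo[) (expR (- t `^ p))%:E =
    (Gamma (1 + p^-1))%:E)%E /\
  (\int[lebesgue_measure]_(t in `]0%R, +oo[) (t `^ p * expR (- t `^ p))%:E =
    (Gamma (1 + p^-1) / p)%:E)%E.
Proof.
move=> p1; have p0 : 0 < p by exact: lt_le_trans p1.
have mexp : measurable_fun setT (fun x : R => expR (- x `^ p)).
  by apply: measurableT_comp => //; apply: measurableT_comp => //; exact: measurable_powR.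
have AB := integral_expRN_powR R p p1.
have CB := integral_Gamma_powR R p p0.
have Afin : (\int[lebesgue_measure]_(t in `]0%R, +oo[) (expR (- t `^ p))%:E \is a fin_num)%E.
  apply: integrable_fin_num => //.
  (* The majorant is [exp (1 - t)]: for [t >= 1] one has [t^p >= t], and for [t < 1] the exponent
     [1 - t] is already positive. *)
  apply: (@le_integrable _ _ _ lebesgue_measure _ _ _
    (fun t => (expR 1)%:E * (expR (- (1 * t)))%:E)%E) => //.
  - by apply/measurable_EFinP; exact: measurable_funTS.
  - move=> t; rewrite /= in_itv/= andbT => t0.
    rewrite lee_fin !ger0_norm ?mulr_ge0 ?expR_ge0// -expRD ler_expR mul1r.
    have [t1|t1] := leP 1 t.
      by have := le1r_powR t1 p1; lra.
    by have := powR_ge0 t p; lra.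
  - by apply: integrableZl => //; exact: integrable_expRNM.
have GA : (\int[lebesgue_measure]_(t in `]0%R, +oo[) (expR (- t `^ p))%:E =
    (Gamma (1 + p^-1))%:E)%E.
  by rewrite /Gamma addrAC subrr add0r CB -AB fineK.
split => //.
have := AB; rewrite GA => E.
by rewrite [_ / p]mulrC EFinM E muleA -EFinM mulVf ?gt_eqF// mul1e.
Qed.

(** * The distribution function near zero *)

Lemma cvg_integral_density_powR (R : realType) (g : R -> R) (alpha beta : R) :
  0 < alpha -> 0 < beta ->
  measurable_fun (`]0%R, +oo[ : set R) g ->
  (forall x, 0 < x -> 0 <= g x) ->
  g x / (alpha * x `^ (beta - 1)) @[x --> (0:R)^'+] --> (1:R) ->
  fine (\int[lebesgue_measure]_(t in `]0%R, x]) (g t)%:E) / x `^ beta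
    @[x --> (0:R)^'+] --> alpha / beta.
Proof.
move=> a0 b0 mg g0 gc.
apply/cvgrPdist_le => e e0.
(* A relative error [e'] in the density becomes an error [e' * alpha / beta] in the quotient, which
   the first entry keeps below [e]. The second entry keeps the lower bound for [g] nonnegative, so
   that integrals can be compared. *)
pose e' := Num.min (e * (beta / alpha)) 1.
have e'0 : 0 < e' by rewrite lt_min ltr01 andbT !mulr_gt0// invr_gt0.
have e'1 : e' <= 1 by rewrite /e' ge_min lexx orbT.
have e'e : e' * (alpha / beta) <= e.
  rewrite -ler_pdivlMr ?divr_gt0// invf_div.
  by rewrite /e' ge_min lexx.
have [d /= d0 dg] : \forall x \near (0:R)^'+,
    `|1 - g x / (alpha * x `^ (beta - 1))| <= e'.
  by have /cvgrPdist_le/(_ _ e'0) := gc.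
have gb t : 0 < t -> t < d ->
    (1 - e') * alpha * t `^ (beta - 1) <= g t <= (1 + e') * alpha * t `^ (beta - 1).
  move=> t0 td; have := dg t; rewrite /= sub0r normrN gtr0_norm// => /(_ td t0).
  have q0 : 0 < alpha * t `^ (beta - 1) by rewrite mulr_gt0// powR_gt0.
  by rewrite ler_distlC ler_pdivrMr// ler_pdivlMr// !mulrA.
near=> x.
have x0 : 0 < x by near: x; exact: nbhs_right_gt.
have xd : x < d by near: x; exact: nbhs_right_lt.
have mI : measurable (`]0%R, x] : set R) by exact: measurable_itv.
have Dx t : (`]0%R, x]%classic : set R) t -> 0 < t /\ t < d.
  by rewrite /= in_itv/= => /andP[-> tx]; split => //; exact: le_lt_trans xd.
have mgx : measurable_fun (`]0%R, x] : set R) (fun t => (g t)%:E).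
  apply/measurable_EFinP; apply: measurable_funS mg => // t /Dx[t0 _].
  by rewrite /= in_itv/= t0.
have mp c : measurable_fun (`]0%R, x] : set R) (fun t => (c * t `^ (beta - 1))%:E).
  by apply/measurable_EFinP; apply: measurable_funTS; apply: measurable_funM => //; exact: measurable_powR.
have pI c : 0 <= c -> (\int[lebesgue_measure]_(t in `]0%R, x]) (c * t `^ (beta - 1))%:E =
    (c * (x `^ beta / beta))%:E)%E.
  move=> c0; under eq_integral do rewrite EFinM.
  rewrite ge0_integralZl//.
  - by rewrite integral_powRB1// EFinM.
  - by apply/measurable_EFinP; apply: measurable_funTS; exact: measurable_powR.
  - by move=> t _; rewrite lee_fin powR_ge0.
have c1 : 0 <= (1 - e') * alpha by rewrite mulr_ge0 ?subr_ge0// ltW.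
have c2 : 0 <= (1 + e') * alpha by rewrite mulr_ge0 ?addr_ge0// ltW.
set I := (\int[_]_(_ in _) _)%E.
have Il : (((1 - e') * alpha * (x `^ beta / beta))%:E <= I)%E.
  rewrite -pI//; apply: ge0_le_integral; [exact: mI| |exact: mp|exact: mgx|].
  - by move=> t _; rewrite lee_fin mulr_ge0// powR_ge0.
  - by move=> t /Dx[t0 td]; have /andP[h _] := gb t t0 td; rewrite lee_fin.
have Iu : (I <= ((1 + e') * alpha * (x `^ beta / beta))%:E)%E.
  rewrite -pI//; apply: ge0_le_integral; [exact: mI| |exact: mgx|exact: mp|].
  - by move=> t /Dx[t0 td]; rewrite lee_fin g0.
  - by move=> t /Dx[t0 td]; have /andP[_ h] := gb t t0 td; rewrite lee_fin.
have I0 : (0 <= I)%E by apply: integral_ge0 => t /Dx[t0 _]; rewrite lee_fin g0.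
have Ifin : I \is a fin_num.
  by rewrite ge0_fin_numE// (le_lt_trans Iu)// ltry.
move: Il Iu; rewrite -(fineK Ifin) !lee_fin; move: (fine I) => y yl yu.
have xb : 0 < x `^ beta by rewrite powR_gt0.
apply: le_trans e'e; rewrite ler_distlC; apply/andP; split.
  rewrite ler_pdivlMr//; apply: le_trans yl.
  by rewrite le_eqVlt; apply/orP; left; apply/eqP; field; rewrite gt_eqF.
rewrite ler_pdivrMr//; apply: (le_trans yu).
by rewrite le_eqVlt; apply/orP; left; apply/eqP; field; rewrite gt_eqF.
Unshelve. all: by end_near. Qed.

(** * Scaling limits of the two series *)

(** Squeeze between [exp (- k y / (1 - y))] and [exp (- k y)]. Both bounds come from
    [1 + x <= exp x], at [x = y / (1 - y)] and at [x = - y]. *)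
Lemma cvg_expr_expRN (R : realType) (y : nat -> R) (k : nat -> nat) (L : R) :
  (forall n, 0 <= y n) -> y n @[n --> \oo] --> (0 : R) ->
  (k n)%:R * y n @[n --> \oo] --> L ->
  (1 - y n) ^+ k n @[n --> \oo] --> expR (- L).
Proof.
move=> y0 cy cky.
have c1 : 1 - y n @[n --> \oo] --> (1 : R).
  by rewrite -[X in _ --> X]subr0; apply: cvgB => //; exact: cvg_cst.
have cl : expR (- ((k n)%:R * y n / (1 - y n))) @[n --> \oo] --> expR (- L).
  apply: (cvg_comp _ expR); last exact: continuous_expR.
  have : (k n)%:R * y n / (1 - y n) @[n --> \oo] --> L * 1^-1.
    by apply: cvgM => //; apply: cvgV.
  by rewrite invr1 mulr1; exact: cvgN.
have cu : expR (- ((k n)%:R * y n)) @[n --> \oo] --> expR (- L).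
  apply: (cvg_comp _ expR); last exact: continuous_expR.
  exact: cvgN.
apply: squeeze_cvgr cl cu.
near=> n.
have y1 : 0 < 1 - y n.
  by near: n; apply: (cvgr_gt _ c1).
have e1 z : expR (- ((k n)%:R * z)) = expR (- z) ^+ k n.
  by rewrite -expRM_natl mulrN.
rewrite -mulrA !e1; apply/andP; split; apply: lerXn2r; rewrite ?nnegrE ?expR_ge0 ?(ltW y1)//.
  rewrite expRN -[leRHS]invrK lef_pV2 ?posrE ?expR_gt0 ?invr_gt0//.
  apply: le_trans (expR_ge1Dx _).
  by rewrite le_eqVlt; apply/orP; left; apply/eqP; field; rewrite gt_eqF.
exact: expR_ge1Dx.
Unshelve. all: by end_near. Qed.

(** Mean value theorem for [x^(b + 1)] on [[j, j + 1]]; [j = 0] is done by hand, since the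
    derivative formula is available only at positive points. *)
Lemma powR_natS_bounds (R : realType) (b : R) (j : nat) : 0 < b ->
  (b + 1) * j%:R `^ b <= j.+1%:R `^ (b + 1) - j%:R `^ (b + 1) <= (b + 1) * j.+1%:R `^ b.
Proof.
move=> b0; have p0 : 0 < b + 1 by lra.
case: j => [|j].
  rewrite !powR0 ?gt_eqF// powR1 /=; lra.
have j0 : 0 < j.+1%:R :> R by [].
have jj : j.+1%:R < j.+2%:R :> R by rewrite ltr_nat.
have dP (x : R) : 0 < x -> is_derive x 1 (fun y : R => y `^ (b + 1)) ((b + 1) * x `^ b).
  by move=> x0; have := @is_derive1_powR _ (b + 1) x x0; rewrite addrK.
have [||c] := @MVT R (fun x => x `^ (b + 1)) (fun x => (b + 1) * x `^ b) _ _ jj.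
- move=> x; rewrite in_itv/= => /andP[jx _]; apply: dP; exact: lt_trans jx.
- apply: continuous_in_subspaceT => x; rewrite inE/= in_itv/= => /andP[jx _].
  by apply: continuous_powR; exact: lt_le_trans jx.
rewrite in_itv/= => /andP[jc cj] ->.
have -> : j.+2%:R - j.+1%:R = 1 :> R by rewrite -natrB// subSnn.
have c0 : 0 < c by exact: lt_trans jc.
rewrite mulr1 !ler_pM2l//; apply/andP; split;
  by apply: ge0_ler_powR; rewrite ?nnegrE ?ltW.
Qed.

(** Summing the increments of [x^(b + 1)]. The two bounds differ only by the shift from [k] to
    [k + 1], which disappears after rescaling. *)
Lemma sum_powR_bounds (R : realType) (b : R) (k : nat) : 0 < b ->
  k%:R `^ (b + 1) / (b + 1) <= \sum_(j < k.+1) j%:R `^ b <=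
  k.+1%:R `^ (b + 1) / (b + 1).
Proof.
move=> b0; have p0 : 0 < b + 1 by lra.
rewrite ler_pdivrMr// ler_pdivlMr//.
elim: k => [|k /andP[IH1 IH2]].
  rewrite big_ord_recr/= big_ord0 !powR0 ?gt_eqF// powR1 add0r mul0r lexx/=; lra.
rewrite big_ord_recr/= mulrDl.
have /andP[h1 _] := @powR_natS_bounds R b k.+1 b0.
have /andP[_ h2] := @powR_natS_bounds R b k b0.
apply/andP; split; lra.
Qed.

(** The function [t -> a (truncn (m t))] is constant on each cell [[k / m, (k + 1) / m)], of length
    [1 / m]. A series divided by [m] thus becomes an integral, to which dominated convergence
    applies. *)
Lemma integral_truncn_step (R : realType) (a : nat -> R) (m : R) :
  0 < m -> (forall k, 0 <= a k) ->
  measurable_fun (`]0%R, +oo[ : set R) (fun t => a (Num.truncn (m * t))) /\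
  (\int[lebesgue_measure]_(t in `]0%R, +oo[) (a (Num.truncn (m * t)))%:E =
   (\sum_(k <oo) (a k)%:E) * (m^-1)%:E)%E.
Proof.
move=> m0 a0.
pose E k : set R := `[k%:R / m, k.+1%:R / m[%classic.
have UE : \bigcup_k E k = `[0%R, +oo[%classic.
  apply/seteqP; split => [t [k _]|t]; rewrite /E/= !in_itv/= ?andbT.
    by move=> /andP[+ _]; apply: le_trans; rewrite divr_ge0 ?(ltW m0).
  move=> t0; exists (Num.truncn (m * t)) => //=.
  rewrite in_itv/= ler_pdivrMr// ltr_pdivlMr// mulrC.
  by apply: truncn_itv; rewrite mulr_ge0 ?(ltW m0).
have Etr k t : E k t -> Num.truncn (m * t) = k.
  rewrite /E/= in_itv/= ler_pdivrMr// ltr_pdivlMr// mulrC.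
  exact: truncn_def.
have mE k : measurable (E k) by exact: measurable_itv.
have mf : measurable_fun (`[0%R, +oo[ : set R) (fun t => a (Num.truncn (m * t))).
  rewrite -UE; apply/measurable_fun_bigcup => // k.
  apply: (eq_measurable_fun (cst (a k))) => // t; rewrite inE => /Etr -> //.
have mf0 : measurable_fun (`]0%R, +oo[ : set R) (fun t => a (Num.truncn (m * t))).
  apply: measurable_funS mf => //; apply: subset_itvr; by rewrite bnd_simp.
split => //.
(* The cells tile the half-line closed at 0; the added endpoint is a null set. *)
rewrite integral_itv_obnd_cbnd; last exact/measurable_EFinP.
rewrite -UE ge0_integral_bigcup//; last 3 first.
- by rewrite UE; exact/measurable_EFinP.
- by move=> t _; rewrite lee_fin.
- apply/trivIsetP => i j _ _ ij; apply/seteqP; split => // t [/Etr ti /Etr tj].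
  by move: ij; rewrite -ti -tj eqxx.
rewrite muleC -nneseriesZl; last by move=> k _; rewrite lee_fin.
apply: eq_eseriesr => k _.
transitivity (\int[lebesgue_measure]_(t in E k) cst (a k)%:E t)%E.
  by apply: eq_integral => t; rewrite inE => /Etr ->.
have muE : lebesgue_measure (E k) = (m^-1)%:E.
  rewrite /E lebesgue_measure_itv/= lte_fin ltr_pM2r ?invr_gt0// ltr_nat ltnSn.
  by rewrite -EFinB -mulrBl -natrB// subSnn mul1r.
transitivity ((a k)%:E * lebesgue_measure (E k))%E; first by rewrite integral_cst; [|exact: measurable_itv].
by rewrite muE muleC.
Qed.

Lemma cvg_truncn_nneseries (R : realType) (a : nat -> nat -> R) (m : nat -> R)
    (f g : R -> R) :
  (forall n, 0 < m n) -> (forall n k, 0 <= a n k) ->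
  measurable_fun (`]0%R, +oo[ : set R) f ->
  lebesgue_measure.-integrable (`]0%R, +oo[ : set R) (EFin \o g) ->
  (\forall n \near \oo, forall t, 0 < t -> a n (Num.truncn (m n * t)) <= g t) ->
  (forall t, 0 < t -> a n (Num.truncn (m n * t)) @[n --> \oo] --> f t) ->
  ((\sum_(k <oo) (a n k)%:E) * ((m n)^-1)%:E)%E @[n --> \oo] -->
  (\int[lebesgue_measure]_(t in `]0%R, +oo[) (f t)%:E)%E.
Proof.
move=> m0 a0 mf ig [N _ agN] caf.
have mD : measurable (`]0%R, +oo[ : set R) by exact: measurable_itv.
(* Domination by [g] holds only from rank [N] on, so the sequence is shifted. *)
rewrite -(cvg_shiftn N)/=.
have Dt (t : R) : (`]0%R, +oo[%classic : set R) t -> 0 < t.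
  by rewrite /= in_itv/= andbT.
have [] := @dominated_convergence _ _ R lebesgue_measure _ mD
  (fun n t => (a (n + N)%N (Num.truncn (m (n + N)%N * t)))%:E) (EFin \o f) (EFin \o g).
- move=> n; apply/measurable_EFinP.
  exact: (integral_truncn_step _ _ _ (m0 (n + N)%N) (a0 (n + N)%N)).1.
- exact/measurable_EFinP.
- apply: aeW => t /Dt t0; apply: cvg_EFin; first exact: nearW.
  have := caf t t0; rewrite -(cvg_shiftn N); exact.
- exact: ig.
- apply: aeW => t n /Dt t0; rewrite gee0_abs ?lee_fin//.
  by apply: agN => //=; rewrite leq_addl.
move=> _ _; apply: cvg_trans; apply: near_eq_cvg; apply: nearW => n /=.
exact: (integral_truncn_step _ _ _ (m0 (n + N)%N) (a0 (n + N)%N)).2.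
Qed.

Lemma cvg_to_at_right (R : realType) (x : nat -> R) (a : R) :
  (\forall n \near \oo, a < x n) -> x n @[n --> \oo] --> a ->
  x n @[n --> \oo] --> a^'+.
Proof.
move=> ax cx P aP; suff : \forall n \near \oo, P (x n) by []; near=> n.
have : a < x n -> P (x n) by near: n; exact: (cx (fun y => a < y -> P y) aP).
by apply; near: n.
Unshelve. all: by end_near. Qed.

Lemma truncn_scaled_bounds (R : realType) (m t : R) : 0 < m -> 0 <= t ->
  (Num.truncn (m * t))%:R / m <= t <= (Num.truncn (m * t))%:R / m + m^-1.
Proof.
move=> m0 t0; have mt0 : 0 <= m * t by rewrite mulr_ge0// ltW.
have /andP[h1 h2] := truncn_itv mt0.
rewrite ler_pdivrMr// [t * m]mulrC h1/= -[X in _ + X]mul1r -mulrDl ler_pdivlMr//.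
rewrite [t * m]mulrC.
by rewrite ltW// natr1.
Qed.

(** This provides the exponential majorant, uniformly in the scale. Write [u = k / m]. If [rho u] is
    small, [F x >= (A / 2) x^b] and the normalisation of [m] give at least [u^(b + 1) / 2];
    otherwise monotonicity bounds [F] below by a constant, and [k >= u]. *)
Lemma truncn_scaled_exponent_lower (R : realType) (F : R -> R) (A b : R) :
  0 < A -> 0 < b -> {homo F : x y / x <= y} -> (forall x, 0 <= F x) ->
  F x / x `^ b @[x --> 0^'+] --> A ->
  exists2 theta, 0 < theta & forall rho m t : R, 0 < rho ->
    m = (A * rho `^ b)^-1 -> 1 <= m -> 0 < t ->
    theta * (t - 2) <=
    (Num.truncn (m * t))%:R * F (rho * ((Num.truncn (m * t))%:R / m)).
Proof.
move=> A0 b0 Fnd F0 FA.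
have : \forall x \near 0^'+, A / 2 < F x / x `^ b.
  by apply: (cvgr_gt _ FA); lra.
move=> [d /= d0 dF].
pose del := d / 2.
have del0 : 0 < del by rewrite divr_gt0.
have Flow x : 0 < x -> x <= del -> A / 2 * x `^ b <= F x.
  move=> x0 xd; rewrite -ler_pdivlMr ?powR_gt0//; apply/ltW/dF => //=.
  by rewrite sub0r normrN gtr0_norm// (le_lt_trans xd)// /del; lra.
have c0 : 0 < A / 2 * del `^ b by rewrite mulr_gt0 ?powR_gt0//; lra.
(* The two entries are the slopes obtained in the two regimes. *)
exists (Num.min 2^-1 (A / 2 * del `^ b)); first by rewrite lt_min c0 andbT invr_gt0.
move=> rho m t rho0 mE m1 t0; set k := Num.truncn _; set theta := Num.min _ _.
have theta0 : 0 < theta by rewrite lt_min c0 andbT invr_gt0.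
have m0 : 0 < m by exact: lt_le_trans m1.
(* For [t <= 2] the lower bound is not positive. For [t > 2], truncation loses at most [1 / m <= 1],
   so [u >= t - 1 >= 1], and [u^b >= 1]. *)
have [t2|t2] := leP t 2.
  apply: (@le_trans _ _ 0); last by rewrite mulr_ge0.
  by rewrite mulr_ge0_le0 ?(ltW theta0)// subr_le0.
have /andP[_] := truncn_scaled_bounds R m t m0 (ltW t0); rewrite -/k => tu.
set u := k%:R / m in tu *.
have mV1 : m^-1 <= 1 by rewrite invf_le1.
have ut : t - 1 <= u by lra.
have u1 : 1 <= u by lra.
have u0 : 0 < u by lra.
have kE : k%:R = m * u by rewrite /u mulrC divfK// gt_eqF.
have [xd|xd] := leP (rho * u) del.
  have h := Flow _ (mulr_gt0 rho0 u0) xd.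
  apply: (@le_trans _ _ (k%:R * (A / 2 * (rho * u) `^ b))); last first.
    by rewrite ler_wpM2l.
  have -> : k%:R * (A / 2 * (rho * u) `^ b) = 2^-1 * (u * u `^ b).
    rewrite powRM ?ltW// kE mE; field.
    by rewrite !gt_eqF ?powR_gt0.
  have ub : 1 <= u `^ b by rewrite -(powRr0 u) ler_powR// ltW.
  have uub : u <= u * u `^ b by rewrite ler_pMr.
  apply: (@le_trans _ _ (2^-1 * (t - 2))).
    by apply: ler_wpM2r; [rewrite subr_ge0 ltW|rewrite /theta ge_min lexx].
  by rewrite ler_pM2l ?invr_gt0//; lra.
apply: (@le_trans _ _ ((A / 2 * del `^ b) * (t - 2))).
  by apply: ler_wpM2r; [rewrite subr_ge0 ltW|rewrite /theta ge_min lexx orbT].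
rewrite mulrC; apply: ler_pM => //; rewrite ?subr_ge0 ?(ltW t2) ?(ltW c0)//.
  rewrite kE (@le_trans _ _ u)//; first lra.
  by rewrite ler_pMl.
by apply: le_trans (Fnd _ _ (ltW xd)); exact: Flow.
Qed.

Lemma cvg_powR_scale0 (R : realType) (A b : R) (rho : nat -> R) : 0 < b ->
  (forall n, 0 < rho n) -> rho n @[n --> \oo] --> (0 : R) ->
  A * rho n `^ b @[n --> \oo] --> (0 : R).
Proof.
move=> b0 rho0 crho.
have : A * rho n `^ b @[n --> \oo] --> A * 0.
  apply: cvgMl_tmp.
  by have /cvg_at_rightP := @powR_cvg0 R b b0; apply.
by rewrite mulr0.
Qed.

(** With [u = k / m] tending to [t] and [x = rho u] tending to [0+], the relation [A rho^b = 1 / m]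
    turns [k F x] into [u^(b + 1) * (F x / x^b) / A]. The sum is compared with the one in which
    [F x] is replaced by [A x^b]. *)
Lemma scaled_limits (R : realType) (F : R -> R) (A b t : R) (rho m : nat -> R) :
  0 < A -> 0 < b -> F 0 = 0 -> F x / x `^ b @[x --> 0^'+] --> A -> 0 < t ->
  (forall n, 0 < rho n) -> rho n @[n --> \oo] --> (0 : R) ->
  (forall n, m n = (A * rho n `^ b)^-1) ->
  let k n := Num.truncn (m n * t) in
  [/\ F (rho n * ((k n)%:R / m n)) @[n --> \oo] --> (0 : R),
      (k n)%:R * F (rho n * ((k n)%:R / m n)) @[n --> \oo] --> t `^ (b + 1) &
      \sum_(j < (k n).+1) F (rho n * (j%:R / m n)) @[n --> \oo] -->
        t `^ (b + 1) / (b + 1)].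
Proof.
move=> A0 b0 F00 FA t0 rho0 crho mE k.
have p0 : 0 < b + 1 by lra.
have m0 n : 0 < m n by rewrite mE invr_gt0 mulr_gt0 ?powR_gt0.
have cmV : (m n)^-1 @[n --> \oo] --> (0 : R).
  under eq_cvg do rewrite mE invrK.
  exact: cvg_powR_scale0.
pose u n := (k n)%:R / m n.
have ub n : u n <= t <= u n + (m n)^-1 := truncn_scaled_bounds R (m n) t (m0 n) (ltW t0).
have cu : u n @[n --> \oo] --> t.
  apply: (@squeeze_cvgr _ _ _ _ (fun n => t - (m n)^-1) (cst t)); last exact: cvg_cst.
    by apply: nearW => n /=; have := ub n; lra.
  by rewrite -[X in _ --> X]subr0; apply: cvgB => //; exact: cvg_cst.
have u0 : \forall n \near \oo, 0 < u n by exact: (cvgr_gt _ cu).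
pose x n := rho n * u n.
have cx : x n @[n --> \oo] --> (0 : R) by rewrite -(mul0r t); exact: cvgM.
have x0 : \forall n \near \oo, 0 < x n.
  by near=> n; rewrite mulr_gt0//; near: n.
have cxr := cvg_to_at_right _ _ _ x0 cx.
have cFx : F (x n) / x n `^ b @[n --> \oo] --> A by exact: (cvg_comp _ _ cxr FA).
have cxb : x n `^ b @[n --> \oo] --> (0 : R) by exact: (cvg_comp _ _ cxr (powR_cvg0 b0)).
have cup q : u n `^ q @[n --> \oo] --> t `^ q.
  exact: (cvg_comp _ _ cu (continuous_powR R q t t0)).
have kE n : (k n)%:R = m n * u n by rewrite /u mulrC divfK// gt_eqF.
split.
- have : x n `^ b * (F (x n) / x n `^ b) @[n --> \oo] --> 0 * A by exact: cvgM.
  rewrite mul0r; apply: cvg_trans; apply: near_eq_cvg; near=> n.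
  have xn0 : 0 < x n by near: n.
  by rewrite mulrC divfK// gt_eqF// powR_gt0.
- have : u n `^ (b + 1) * (F (x n) / x n `^ b) / A @[n --> \oo] --> t `^ (b + 1) * A / A.
    by apply: cvgMr_tmp; apply: cvgM.
  rewrite mulfK ?gt_eqF//; apply: cvg_trans; apply: near_eq_cvg; near=> n.
  have un0 : 0 < u n by near: n.
  rewrite -/(u n) -/(x n) kE powRD ?gt_eqF ?implybT// powRr1 ?ltW//.
  rewrite {2}/x powRM ?ltW// mE; field.
  by rewrite !gt_eqF ?powR_gt0.
(* The model sum: its scale factors out as [m^(-(b + 1))], leaving a sum of powers of integers. *)
pose P n := \sum_(j < (k n).+1) A * (rho n * (j%:R / m n)) `^ b.
have PE n : P n = (m n) `^ (- (b + 1)) * \sum_(j < (k n).+1) j%:R `^ b.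
  rewrite /P mulr_sumr; apply: eq_bigr => j _.
  rewrite powRM ?mulr_ge0 ?invr_ge0 ?(ltW (m0 n)) ?(ltW (rho0 n))//.
  rewrite powRM ?invr_ge0 ?(ltW (m0 n))// mulrA mulrA.
  have -> : A * rho n `^ b = (m n)^-1 by rewrite mE invrK.
  rewrite mulrAC; congr (_ * _).
  rewrite -powR_inv1 ?(ltW (m0 n))// -powRrM -powRD ?(gt_eqF (m0 n)) ?implybT//.
  by congr (_ `^ _); ring.
have mpow n (y : R) : 0 <= y -> (m n) `^ (- (b + 1)) * y `^ (b + 1) = (y / m n) `^ (b + 1).
  move=> y0; rewrite powRM ?invr_ge0 ?(ltW (m0 n))// mulrC; congr (_ * _).
  by rewrite -powR_inv1 ?(ltW (m0 n))// -powRrM mulN1r.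
have cP : P n @[n --> \oo] --> t `^ (b + 1) / (b + 1).
  apply: (@squeeze_cvgr _ _ _ _ (fun n => u n `^ (b + 1) / (b + 1))
    (fun n => (u n + (m n)^-1) `^ (b + 1) / (b + 1))).
  - apply: nearW => n; have /andP[h1 h2] := @sum_powR_bounds R b (k n) b0.
    rewrite PE; apply/andP; split.
      by rewrite /u -mpow// -mulrA ler_pM2l ?powR_gt0.
    have -> : u n + (m n)^-1 = (k n).+1%:R / m n.
      by rewrite /u -[X in _ + X]mul1r -mulrDl natr1.
    by rewrite -mpow// -[leRHS]mulrA ler_pM2l ?powR_gt0.
  - exact: cvgMr_tmp.
  - apply: cvgMr_tmp.
    have c1 : u n + (m n)^-1 @[n --> \oo] --> t.
      by rewrite -[X in _ --> X]addr0; exact: cvgD.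
    exact: (cvg_comp _ _ c1 (continuous_powR R (b + 1) t t0)).
pose G n := \sum_(j < (k n).+1) F (rho n * (j%:R / m n)).
suff cGP : G n - P n @[n --> \oo] --> (0 : R).
  have : (G n - P n) + P n @[n --> \oo] --> 0 + t `^ (b + 1) / (b + 1) by exact: cvgD.
  by rewrite add0r; under eq_cvg do rewrite subrK.
apply/cvgr0Pnorm_le => e e0.
(* An eventual bound for [P n]. A relative error [e / M] in every term then costs at most
   [e / M * P n <= e] in total. *)
pose M := t `^ (b + 1) / (b + 1) + 1.
have M0 : 0 < M by rewrite /M ltr_wpDl// divr_ge0 ?powR_ge0 ?ltW.
have eM : 0 < e / M * A by rewrite mulr_gt0// divr_gt0.
have [d /= d0 dF] : \forall x \near 0^'+, `|A - F x / x `^ b| < e / M * A.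
  by have /cvgrPdist_lt/(_ _ eM) := FA.
near=> n.
have PM : P n <= M.
  apply/ltW; near: n; apply: (cvgr_lt _ cP); rewrite /M; lra.
have xd : x n < d by near: n; apply: (cvgr_lt _ cx).
rewrite /G /P -sumrB; apply: (le_trans (ler_norm_sum _ _ _)).
apply: (@le_trans _ _ (e / M * P n)); last first.
  by rewrite mulrAC ler_pdivrMr// ler_pM2l.
rewrite /P mulr_sumr; apply: ler_sum => j _.
(* The ratio [F x / x^b] says nothing at [x = 0], but there both terms vanish. *)
have [->|j0] := eqVneq (nat_of_ord j) 0%N.
  by rewrite mul0r mulr0 F00 powR0 ?gt_eqF// !mulr0 subr0 normr0.
have y0 : 0 < rho n * (j%:R / m n).
  by rewrite mulr_gt0// divr_gt0// ltr0n lt0n.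
have yd : rho n * (j%:R / m n) < d.
  apply: le_lt_trans xd; rewrite /x /u ler_pM2l// ler_pM2r ?invr_gt0// ler_nat.
  by rewrite -ltnS.
set y := rho n * _ in y0 yd *.
have yb0 : 0 < y `^ b by rewrite powR_gt0.
have : `|A - F y / y `^ b| < e / M * A.
  by apply: dF => //=; rewrite sub0r normrN gtr0_norm.
move=> /ltW h.
have -> : F y - A * y `^ b = - ((A - F y / y `^ b) * y `^ b).
  by rewrite mulrBl divfK ?gt_eqF// opprB.
by rewrite normrN normrM (gtr0_norm yb0) mulrA ler_pM2r.
Unshelve. all: by end_near. Qed.

(* The normalisation [m = (A rho^b)^-1] is the one that makes
   [k * F (rho * k / m)] tend to [t^(b+1)] when [k / m] tends to [t]. *)
Lemma cvg_scaled_series (R : realType) (F : R -> R) (A b : R) (rho m : nat -> R) :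
  0 < A -> 0 < b -> {homo F : x y / x <= y} -> (forall x, 0 <= F x <= 1) ->
  F 0 = 0 -> F x / x `^ b @[x --> 0^'+] --> A ->
  (forall n, 0 < rho n) -> rho n @[n --> \oo] --> (0 : R) ->
  (forall n, m n = (A * rho n `^ b)^-1) ->
  ((\sum_(k <oo) ((1 - F (rho n * (k%:R / m n))) ^+ k)%:E) * ((m n)^-1)%:E)%E
    @[n --> \oo] --> ((Gamma (1 + (b + 1)^-1))%:E)%E /\
  ((\sum_(k <oo) ((1 - F (rho n * (k%:R / m n))) ^+ k *
     \sum_(j < k.+1) F (rho n * (j%:R / m n)))%:E) * ((m n)^-1)%:E)%E
    @[n --> \oo] --> ((Gamma (1 + (b + 1)^-1) / (b + 1) ^+ 2)%:E)%E.
Proof.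
move=> A0 b0 Fnd F01 F00 FA rho0 crho mE.
have p0 : 0 < b + 1 by lra.
have p1 : 1 <= b + 1 by lra.
have F0 x : 0 <= F x by have /andP[] := F01 x.
have F1 x : 0 <= 1 - F x by rewrite subr_ge0; have /andP[] := F01 x.
have m0 n : 0 < m n by rewrite mE invr_gt0 mulr_gt0 ?powR_gt0.
have cmV : (m n)^-1 @[n --> \oo] --> (0 : R).
  under eq_cvg do rewrite mE invrK.
  exact: cvg_powR_scale0.
have m1 : \forall n \near \oo, 1 <= m n.
  near=> n; rewrite -[leRHS]invrK invf_ge1 ?invr_gt0//.
  by apply/ltW; near: n; apply: (cvgr_lt _ cmV).
have [theta theta0 low] := truncn_scaled_exponent_lower R F A b A0 b0 Fnd F0 FA.
(* One majorant for both series: [4 exp (- y / 2)] at the linear lower bound [y = theta (t - 2)].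
   The factor 4 comes from [2 y exp (- y) <= 4 exp (- y / 2)] in the second series. *)
pose g (t : R) := 4 * expR theta * expR (- (theta / 2 * t)).
have ig : lebesgue_measure.-integrable (`]0%R, +oo[ : set R) (EFin \o g).
  have c0 : 0 < theta / 2 by rewrite divr_gt0.
  apply: eq_integrable (integrableZl _ (4 * expR theta) (integrable_expRNM R _ c0)) => //.
have gE (y t : R) : theta * (t - 2) <= y -> 4 * expR (- (y / 2)) <= g t.
  move=> ty; rewrite /g -mulrA -expRD ler_pM2l// ler_expR.
  lra.
have powle k x : (1 - F x) ^+ k <= expR (- (k%:R * F x)).
  rewrite -mulrN expRM_natl; apply: lerXn2r; rewrite ?nnegrE ?expR_ge0//.
  exact: expR_ge1Dx.
have mpow : measurable_fun setT (fun t : R => t `^ (b + 1)) by exact: measurable_powR.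
have mexp : measurable_fun setT (fun t : R => expR (- t `^ (b + 1))).
  by apply: measurableT_comp => //; exact: measurableT_comp.
have [G1 G2] := GammaE R (b + 1) p1.
split.
- rewrite -G1.
  apply: (@cvg_truncn_nneseries R (fun n k => (1 - F (rho n * (k%:R / m n))) ^+ k) m
    (fun t => expR (- t `^ (b + 1))) g) => //.
  + by move=> n k; rewrite exprn_ge0.
  + exact: measurable_funTS.
  + near=> n => t t0.
    have h := low (rho n) (m n) t (rho0 n) (mE n) _ t0.
    have {}h : theta * (t - 2) <= (Num.truncn (m n * t))%:R *
        F (rho n * ((Num.truncn (m n * t))%:R / m n)) by apply: h; near: n.
    apply: le_trans (gE _ _ h); apply: (le_trans (powle _ _)).
    set y := _ * F _; have y0 : 0 <= y by rewrite mulr_ge0.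
    apply: (@le_trans _ _ (expR (- (y / 2)))); first by rewrite ler_expR; lra.
    by have := expR_ge0 (- (y / 2)); lra.
  + move=> t t0.
    have [c1 c2 _] := scaled_limits R F A b t rho m A0 b0 F00 FA t0 rho0 crho mE.
    exact: cvg_expr_expRN.
(* One factor [1 / p] comes from the limit of the inner sum, the other from the integral of
   [t^p exp (- t^p)]. *)
- have -> : ((Gamma (1 + (b + 1)^-1) / (b + 1) ^+ 2)%:E =
     \int[lebesgue_measure]_(t in `]0%R, +oo[)
       (t `^ (b + 1) * expR (- t `^ (b + 1)) / (b + 1))%:E)%E.
    transitivity (((b + 1)^-1)%:E * \int[lebesgue_measure]_(t in `]0%R, +oo[)
       (t `^ (b + 1) * expR (- t `^ (b + 1)))%:E)%E.
      by rewrite G2 -EFinM; congr EFin; field; rewrite gt_eqF.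
    rewrite -ge0_integralZl//.
    + by apply: eq_integral => t _; rewrite -EFinM mulrC.
    + by apply/measurable_EFinP; apply: measurable_funTS; exact: measurable_funM.
    + by move=> t _; rewrite lee_fin mulr_ge0 ?powR_ge0 ?expR_ge0.
    + by rewrite lee_fin invr_ge0 ltW.
  apply: (@cvg_truncn_nneseries R (fun n k => (1 - F (rho n * (k%:R / m n))) ^+ k *
     \sum_(j < k.+1) F (rho n * (j%:R / m n))) m
    (fun t => t `^ (b + 1) * expR (- t `^ (b + 1)) / (b + 1)) g) => //.
  + by move=> n k; rewrite mulr_ge0 ?exprn_ge0// sumr_ge0.
  + apply: measurable_funM => //; apply: measurable_funTS; exact: measurable_funM.
  + near=> n => t t0.
    have h := low (rho n) (m n) t (rho0 n) (mE n) _ t0.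
    have {}h : theta * (t - 2) <= (Num.truncn (m n * t))%:R *
        F (rho n * ((Num.truncn (m n * t))%:R / m n)) by apply: h; near: n.
    apply: le_trans (gE _ _ h); set k := Num.truncn _.
    have := powle k (rho n * (k%:R / m n)).
    have y0 : 0 <= k%:R * F (rho n * (k%:R / m n)) by rewrite mulr_ge0.
    (* Each of the [k + 1] terms is at most the last one, and [k + 1 <= 2 k] for [k >= 1]; for
       [k = 0] the sum is [F 0 = 0]. *)
    have sumle : \sum_(j < k.+1) F (rho n * (j%:R / m n)) <=
        2 * (k%:R * F (rho n * (k%:R / m n))).
      have [->|k0] := posnP k.
        by rewrite big_ord_recr/= big_ord0 !mul0r !mulr0 F00 addr0.
      apply: (@le_trans _ _ (\sum_(j < k.+1) F (rho n * (k%:R / m n)))).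
        apply: ler_sum => j _; apply: Fnd.
        by rewrite ler_pM2l// ler_pM2r ?invr_gt0// ler_nat -ltnS.
      rewrite sumr_const card_ord -[leLHS]mulr_natl mulrA ler_wpM2r//.
      have : 1 <= k%:R :> R by rewrite ler1n.
      by rewrite -natr1; lra.
    set y := k%:R * F _ in y0 sumle *; move=> powle1.
    apply: (@le_trans _ _ (expR (- y) * (2 * y))).
      by apply: ler_pM => //; rewrite ?exprn_ge0// sumr_ge0.
    have -> : expR (- y) = expR (- (y / 2)) * expR (- (y / 2)).
      by rewrite -expRD; congr expR; lra.
    rewrite -mulrA mulrC ler_pM2r ?expR_gt0//.
    have h2 : y / 2 <= expR (y / 2) by have := expR_ge1Dx (y / 2); lra.
    have : expR (- (y / 2)) * (y / 2) <= expR (- (y / 2)) * expR (y / 2).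
      by rewrite ler_pM2l ?expR_gt0.
    by rewrite -expRD addNr expR0; lra.
  + move=> t t0.
    have [c1 c2 c3] := scaled_limits R F A b t rho m A0 b0 F00 FA t0 rho0 crho mE.
    rewrite mulrAC mulrC; apply: cvgM => //.
    exact: cvg_expr_expRN.
Unshelve. all: by end_near. Qed.

(** * The stopping time and the regret *)

(** The default value of the minimum is the mean of the first arm, which for [k > 0] is already
    among the terms. *)
Lemma runmin_leP (T : Type) (R : realType) (mu : nat -> T -> R) (k : nat) (w : T) (x : R) :
  (0 < k)%N -> runmin mu k w <= x <-> exists2 i, (i < k)%N & mu i w <= x.
Proof.
move=> k0; split => [|[i ik mui]]; last exact: (@bigmin_inf _ _ _ _ (Ordinal ik)).
apply: contraPP => h; apply/negP; rewrite -ltNge; apply/bigmin_gtP.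
have {}h i : (i < k)%N -> x < mu i w.
  by move=> ik; rewrite ltNge; apply/negP => mui; apply: h; exists i.
by split => [|i _]; exact: h.
Qed.

Lemma measurable_runmin (d : measure_display) (T : measurableType d) (R : realType)
    (mu : nat -> T -> R) (k : nat) :
  (forall i, measurable_fun setT (mu i)) -> measurable_fun setT (runmin mu k).
Proof.
move=> mmu; rewrite /runmin.
under eq_fun do rewrite -(big_mkord xpredT (fun i => mu i _)).
elim: (index_iota 0 k) => [|i r IH].
  by under eq_fun do rewrite big_nil; exact: mmu.
by under eq_fun do rewrite big_cons; exact: measurable_minr.
Qed.

(** The stopping level grows without bound, so it eventually passes the first mean alone. This rules
    out the default branch of [Kstop]. *)
Lemma Kstop_stops (T : Type) (R : realType) (mu : nat -> T -> R) (lam : R) (n : nat) (w : T) :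
  0 < lam -> (0 < n)%N ->
  stops mu lam n w (Kstop mu lam n w) /\
  (forall k, stops mu lam n w k -> (Kstop mu lam n w <= k)%N).
Proof.
move=> lam0 n0; have nR : 0 < n%:R :> R by rewrite ltr0n.
have ex : exists k, stops mu lam n w k.
  exists (Num.truncn (`|mu 0%N w| * n%:R / lam)).+1; rewrite /stops /=.
  apply/runmin_leP => //; exists 0%N => //.
  apply: le_trans (ler_norm _) _.
  rewrite ler_pdivlMr// -ler_pdivrMr//.
  exact/ltW/truncnS_gt.
rewrite /Kstop; case: pselect => // h; split; first by case: ex_minnP.
by move=> k sk; case: ex_minnP => m _; exact.
Qed.

(** Levels increase: a mean below the level at time [K] stays below it at every later time, so
    survival past [k] can be read off the level at [k] alone. For [k = 0] both sides hold. *)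
Lemma Kstop_gtP (T : Type) (R : realType) (mu : nat -> T -> R) (lam : R) (n k : nat) (w : T) :
  0 < lam -> (0 < n)%N ->
  (k < Kstop mu lam n w)%N <-> (forall i, (i < k)%N -> k%:R * lam / n%:R < mu i w).
Proof.
move=> lam0 n0; have nR : 0 < n%:R :> R by rewrite ltr0n.
have [/andP[K0 sK] minK] := Kstop_stops T R mu lam n w lam0 n0.
split => [kK i ik|h].
  rewrite ltNge; apply/negP => mui.
  suff /minK : stops mu lam n w k by rewrite leqNgt kK.
  rewrite /stops (leq_ltn_trans _ ik)//=; apply/runmin_leP; last by exists i.
  exact: leq_ltn_trans ik.
rewrite ltnNge; apply/negP => Kk.
have /(runmin_leP _ _ _ _ _ _ K0)[i iK mui] := sK.
have := h i (leq_trans iK Kk); rewrite ltNge => /negP; apply.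
by rewrite (le_trans mui)// ler_pM2r ?invr_gt0// ler_pM2r// ler_nat.
Qed.

Lemma nneseries_finite (R : realType) (a : nat -> \bar R) (N : nat) :
  (forall k, (N <= k)%N -> a k = 0%E) ->
  (\sum_(k <oo) a k = \sum_(k < N) a k)%E.
Proof.
move=> a0; apply/cvg_lim => //; apply: cvg_near_cst; exists N => // m /= Nm.
rewrite -(big_mkord xpredT a) (big_cat_nat (leq0n N) Nm)//=.
rewrite [X in (_ + X)%E]big_nat_cond [X in (_ + X)%E]big1 ?adde0// => k.
by rewrite andbT => /andP[Nk _]; exact: a0.
Qed.

Lemma count_ge_bounds (R : realType) (z : R) (K : nat) : 0 <= z -> z <= K%:R ->
  K%:R - z - 1 <= \sum_(j < K) (z <= j%:R)%R%:R <= K%:R - z.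
Proof.
move=> z0; elim: K => [|K IH] zK.
  by rewrite big_ord0; move: zK => /=; lra.
rewrite big_ord_recr/=; have [zk|zk] := leP z K%:R.
  by have := IH zk; rewrite -natr1 /= mulr1n; lra.
rewrite addr0 big1 => [|j _]; first by move: zK zk; rewrite -natr1; lra.
rewrite leNgt (le_lt_trans _ zk)// ler_nat; exact/ltnW.
Qed.

(* The running minimum of the first [k] arms exceeds [k lam / n]; since the
   stopping level increases with [k], this says exactly that [k < K]. *)
Definition active (T : Type) (R : realType) (mu : nat -> T -> R) (lam : R) (n k : nat) : set T :=
  \bigcap_(i in [set` iota 0 k]) (mu i @^-1` `]k%:R * lam / n%:R, +oo[).

Lemma set_iota0E (k i : nat) : [set` iota 0 k] i = (i < k)%N :> Prop.
Proof. by rewrite /= mem_iota. Qed.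

Lemma activeE (T : Type) (R : realType) (mu : nat -> T -> R) (lam : R) (n k : nat) (w : T) :
  0 < lam -> (0 < n)%N -> active T R mu lam n k w <-> (k < Kstop mu lam n w)%N.
Proof.
move=> lam0 n0; rewrite (Kstop_gtP T R mu lam n k w lam0 n0); split => h i.
  move=> ik; have := h i; rewrite /= mem_iota /= add0n in_itv/= andbT; exact.
by rewrite /= mem_iota add0n /= => ik; rewrite in_itv/= andbT; exact: h.
Qed.

Lemma Kstop_series (T : Type) (R : realType) (mu : nat -> T -> R) (lam : R) (n : nat) (w : T) :
  0 < lam -> (0 < n)%N ->
  (((Kstop mu lam n w)%:R : R)%:E = \sum_(k <oo) (\1_(active T R mu lam n k) w)%:E)%E.
Proof.
move=> lam0 n0; set K := Kstop _ _ _ _.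
have aE k : \1_(active T R mu lam n k) w = (k < K)%:R :> R.
  rewrite indicE; congr (_%:R); congr nat_of_bool.
  by apply/idP/idP => [/set_mem|] h; [|apply/mem_set]; exact/activeE.
rewrite (nneseries_finite R _ K) => [|k Kk]; last by rewrite aE ltnNge Kk.
rewrite sumEFin; congr EFin; under eq_bigr do rewrite aE ltn_ord.
by rewrite sumr_const card_ord.
Qed.

(* For [j <= k]: experimentation stops at arm [k] (counted from 0) because its
   own mean is small, and this mean is at most [j lam / n]. *)
Definition dropout (T : Type) (R : realType) (mu : nat -> T -> R) (lam : R) (n k j : nat) : set T :=
  \bigcap_(i in [set` iota 0 k.+1]) (mu i @^-1`
    (if (i < k)%N then `]k%:R * lam / n%:R, +oo[%classic else `]-oo, j%:R * lam / n%:R]%classic)).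

Lemma dropoutE (T : Type) (R : realType) (mu : nat -> T -> R) (lam : R) (n k j : nat) (w : T) :
  dropout T R mu lam n k j w <->
  active T R mu lam n k w /\ mu k w <= j%:R * lam / n%:R.
Proof.
split => [h|[h1 h2] i]; last first.
  rewrite set_iota0E ltnS leq_eqVlt => /predU1P[->|ik].
    by rewrite ltnn /= in_itv.
  by rewrite ik; apply: h1; rewrite set_iota0E.
split => [i|].
  rewrite set_iota0E => ik; have := h i.
  by rewrite set_iota0E ltnS (ltnW ik) ik; exact.
by have := h k; rewrite set_iota0E ltnS leqnn ltnn /= in_itv/=; exact.
Qed.

Lemma dropout_series (T : Type) (R : realType) (mu : nat -> T -> R) (lam : R) (n : nat) (w : T) :
  0 < lam -> (0 < n)%N ->
  (\sum_(k <oo) \sum_(j < k.+1) (\1_(dropout T R mu lam n k j) w : R)%:E =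
   (\sum_(j < Kstop mu lam n w)
     (runmin mu (Kstop mu lam n w) w <= j%:R * lam / n%:R)%R%:R)%:E)%E.
Proof.
move=> lam0 n0; have nR : 0 < n%:R :> R by rewrite ltr0n.
have [/andP[K0 sK] minK] := Kstop_stops T R mu lam n w lam0 n0.
have cle (i j : nat) : (i <= j)%N -> i%:R * lam / n%:R <= j%:R * lam / n%:R :> R.
  by move=> ij; rewrite ler_pM2r ?invr_gt0// ler_pM2r// ler_nat.
case: (Kstop mu lam n w) (activeE T R mu lam n ^~ w) K0 sK minK => // q aE _ sK minK.
have D0 k : k != q -> (\sum_(j < k.+1) (\1_(dropout T R mu lam n k j) w : R)%:E = 0)%E.
  move=> kq; apply: big1 => j _; congr EFin; rewrite indicE memNset// => /dropoutE[].
  move=> /(aE _ lam0 n0); rewrite ltnS leq_eqVlt (negbTE kq)/= => kq' muk.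
  suff /minK : stops mu lam n w k.+1 by rewrite ltnS leqNgt kq'.
  rewrite /stops/=; apply/runmin_leP => //; exists k => //.
  by rewrite (le_trans muk)// cle// ltnW// ltn_ord.
rewrite (nneseries_finite R _ q.+1) => [|k qk]; last by apply: D0; rewrite gt_eqF.
rewrite big_ord_recr/= big1 ?add0e => [|k _]; last by apply: D0; rewrite neq_ltn ltn_ord.
rewrite sumEFin; congr EFin; apply: eq_bigr => j _; rewrite indicE; congr (_%:R).
congr nat_of_bool; apply/idP/idP.
  move=> /set_mem/dropoutE[_ muq]; apply/runmin_leP => //; exists q => //.
move=> /(runmin_leP _ _ _ _ _ _ (ltn0Sn q))[i iq mui]; apply/mem_set/dropoutE.
have aq : active T R mu lam n q w by apply/aE.
split => //; move: iq; rewrite ltnS leq_eqVlt => /predU1P[iq|iq].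
  by move: mui; rewrite iq.
have := aq i; rewrite set_iota0E /= in_itv/= andbT => /(_ iq).
rewrite ltNge => /negP; case; rewrite (le_trans mui)// cle// -ltnS//.
Qed.

Lemma runmin_Kstop_bounds (T : Type) (R : realType) (mu : nat -> T -> R) (lam : R) (n : nat)
    (w : T) (K := Kstop mu lam n w) (M := runmin mu K w) :
  0 < lam -> (0 < n)%N -> 0 <= M ->
  M + lam / n%:R * \sum_(j < K) (M <= j%:R * lam / n%:R)%R%:R <= lam / n%:R * K%:R <=
  M + lam / n%:R * \sum_(j < K) (M <= j%:R * lam / n%:R)%R%:R + lam / n%:R.
Proof.
move=> lam0 n0 M0; have nR : 0 < n%:R :> R by rewrite ltr0n.
have [/andP[K0 sK] _] := Kstop_stops T R mu lam n w lam0 n0.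
have h0 : 0 < lam / n%:R by rewrite divr_gt0.
pose z := M / (lam / n%:R).
have ME : M = lam / n%:R * z by rewrite /z mulrC divfK// gt_eqF.
have z0 : 0 <= z by rewrite divr_ge0// ltW.
have zK : z <= K%:R by rewrite ler_pdivrMr// mulrA.
have sumE : \sum_(j < K) (M <= j%:R * lam / n%:R)%R%:R = \sum_(j < K) (z <= j%:R)%R%:R :> R.
  apply: eq_bigr => j _; congr (_%:R); congr nat_of_bool.
  by rewrite ler_pdivrMr// mulrA.
have := count_ge_bounds R z K z0 zK; rewrite -sumE => /andP[b1 b2].
move: (\sum_(j < K) _) (lam / n%:R) h0 ME b1 b2 => s h h0 -> b1 b2.
have e1 : h * (z + s) <= h * K%:R by rewrite ler_pM2l//; lra.
have e2 : h * K%:R <= h * (z + s + 1) by rewrite ler_pM2l//; lra.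
by apply/andP; split; lra.
Qed.

Lemma measurable_preimageT (d : measure_display) (T : measurableType d) (R : realType)
    (f : T -> R) (A : set R) :
  measurable_fun setT f -> measurable A -> measurable (f @^-1` A).
Proof. by move=> mf mA; rewrite -[X in measurable X]setTI; exact: mf. Qed.

Lemma measurable_active (d : measure_display) (T : measurableType d) (R : realType)
    (mu : nat -> T -> R) (lam : R) (n k : nat) :
  (forall i, measurable_fun setT (mu i)) -> measurable (active T R mu lam n k).
Proof.
move=> mmu; apply: bigcap_measurableType => i _.
by apply: measurable_preimageT => //; exact: measurable_itv.
Qed.

Lemma measurable_dropout (d : measure_display) (T : measurableType d) (R : realType)
    (mu : nat -> T -> R) (lam : R) (n k j : nat) :
  (forall i, measurable_fun setT (mu i)) -> measurable (dropout T R mu lam n k j).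
Proof.
move=> mmu; apply: bigcap_measurableType => i _.
by apply: measurable_preimageT => //; case: ifP => _; exact: measurable_itv.
Qed.

Lemma probability_preimage_gt (d : measure_display) (T : measurableType d) (R : realType)
    (P : probability T R) (f : T -> R) (F : R -> R) (x : R) :
  measurable_fun setT f -> P (f @^-1` `]-oo, x]) = (F x)%:E ->
  P (f @^-1` `]x, +oo[) = (1 - F x)%:E.
Proof.
move=> mf FE; have -> : f @^-1` `]x, +oo[ = ~` (f @^-1` `]-oo, x]).
  by apply/seteqP; split => w /=; rewrite !in_itv/= andbT ltNge => /negP.
rewrite probability_setC ?FE//.
by apply: measurable_preimageT => //; exact: measurable_itv.
Qed.

Lemma probability_active (d : measure_display) (T : measurableType d) (R : realType)
    (P : probability T R) (mu : nat -> T -> R) (F : R -> R) (lam : R) (n k : nat) :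
  (forall i, measurable_fun setT (mu i)) ->
  (forall i x, P (mu i @^-1` `]-oo, x]) = (F x)%:E) ->
  mutually_independent P mu ->
  P (active T R mu lam n k) = ((1 - F (k%:R * lam / n%:R)) ^+ k)%:E.
Proof.
move=> mmu FE ind; set c := k%:R * lam / n%:R.
rewrite /active (ind (iota 0 k) (fun=> `]c, +oo[%classic)) ?iota_uniq//.
under eq_bigr do rewrite (probability_preimage_gt _ _ _ _ _ _ _ (mmu _) (FE _ _)).
have -> : iota 0 k = index_iota 0 k by rewrite /index_iota subn0.
by rewrite prodEFin prodr_const_nat subn0.
Qed.

Lemma probability_dropout (d : measure_display) (T : measurableType d) (R : realType)
    (P : probability T R) (mu : nat -> T -> R) (F : R -> R) (lam : R) (n k j : nat) :
  (forall i, measurable_fun setT (mu i)) ->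
  (forall i x, P (mu i @^-1` `]-oo, x]) = (F x)%:E) ->
  mutually_independent P mu ->
  P (dropout T R mu lam n k j) =
    ((1 - F (k%:R * lam / n%:R)) ^+ k * F (j%:R * lam / n%:R))%:E.
Proof.
move=> mmu FE ind; rewrite /dropout.
set c := k%:R * lam / n%:R; set c' := j%:R * lam / n%:R.
rewrite (ind (iota 0 k.+1) (fun i => if (i < k)%N then `]c, +oo[%classic
  else `]-oo, c']%classic)) ?iota_uniq//; last first.
  by move=> i _; case: ifP => _; exact: measurable_itv.
rewrite -[iota 0 k.+1]/(index_iota 0 k.+1) big_nat_recr//= ltnn FE.
rewrite [X in (X * _)%E](_ : _ = ((1 - F c) ^+ k)%:E) -?EFinM//.
transitivity (\prod_(0 <= i < k) (1 - F c)%:E)%E.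
  apply: eq_big_nat => i /andP[_ ik]; rewrite ik.
  exact: (probability_preimage_gt _ _ _ _ _ _ _ (mmu _) (FE _ _)).
by rewrite prodEFin prodr_const_nat subn0.
Qed.

Lemma measurable_Kstop_eq (d : measure_display) (T : measurableType d) (R : realType)
    (mu : nat -> T -> R) (lam : R) (n k : nat) :
  0 < lam -> (0 < n)%N -> (forall i, measurable_fun setT (mu i)) ->
  measurable [set w | Kstop mu lam n w = k.+1].
Proof.
move=> lam0 n0 mmu.
have -> : [set w | Kstop mu lam n w = k.+1] =
    active T R mu lam n k `\` active T R mu lam n k.+1.
  apply/seteqP; split => [w /= Kk|w [/(activeE _ _ _ _ _ _ _ lam0 n0) kK aN]].
    by split; [|move=> /=]; rewrite activeE// Kk ?ltnSn ?ltnn.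
  apply/eqP; rewrite eqn_leq kK andbT leqNgt; apply/negP => kK'.
  by apply: aN; apply/activeE.
by apply: measurableD; exact: measurable_active.
Qed.

Lemma measurable_fun_Kstop (d : measure_display) (T : measurableType d) (R : realType)
    (mu : nat -> T -> R) (lam : R) (n : nat) (f : nat -> T -> R) :
  0 < lam -> (0 < n)%N -> (forall i, measurable_fun setT (mu i)) ->
  (forall k, measurable_fun setT (f k)) ->
  measurable_fun setT (fun w => f (Kstop mu lam n w) w).
Proof.
move=> lam0 n0 mmu mf.
have -> : [set: T] = \bigcup_k [set w | Kstop mu lam n w = k.+1].
  apply/seteqP; split => // w _; exists (Kstop mu lam n w).-1 => //=.
  have [/andP[K0 _] _] := Kstop_stops T R mu lam n w lam0 n0.
  by rewrite prednK.
apply/measurable_fun_bigcup => [k|k]; first exact: measurable_Kstop_eq.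
apply: (eq_measurable_fun (f k.+1)); last exact: measurable_funTS.
by move=> w; rewrite inE /= => ->.
Qed.

Lemma regret_bounds (d : measure_display) (T : measurableType d) (R : realType)
    (P : probability T R) (mu : nat -> T -> R) (F : R -> R) (lam : R) (n : nat) (S N : R) :
  0 < lam -> (0 < n)%N ->
  (forall i, measurable_fun setT (mu i)) ->
  (forall i x, P (mu i @^-1` `]-oo, x]) = (F x)%:E) -> F 0 = 0 ->
  mutually_independent P mu ->
  (\sum_(k <oo) ((1 - F (k%:R * lam / n%:R)) ^+ k)%:E = S%:E)%E ->
  (\sum_(k <oo) ((1 - F (k%:R * lam / n%:R)) ^+ k *
     \sum_(j < k.+1) F (j%:R * lam / n%:R))%:E = N%:E)%E ->
  ((lam * (2 * S - N - 1))%:E <= regret P mu lam n <= (lam * (2 * S - N))%:E)%E.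
Proof.
move=> lam0 n0 mmu FE F00 ind SE NE; have nR : 0 < n%:R :> R by rewrite ltr0n.
pose K w := Kstop mu lam n w; pose M w := runmin mu (K w) w.
pose h := lam / n%:R; have h0 : 0 < h by rewrite divr_gt0.
have mA k : measurable (active T R mu lam n k) by exact: measurable_active.
have mD k j : measurable (dropout T R mu lam n k j) by exact: measurable_dropout.
pose D w := (\sum_(j < K w) (M w <= j%:R * lam / n%:R)%R%:R : R).
have EK : (\int[P]_w ((K w)%:R)%:E = S%:E)%E.
  under eq_integral do rewrite (Kstop_series T R mu lam n _ lam0 n0).
  rewrite integral_nneseries//.
  - rewrite -SE; apply: eq_eseriesr => k _.
    rewrite integral_indic// setIT; exact: probability_active.
  - by move=> k; apply/measurable_EFinP; exact: measurable_indic.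
have ED : (\int[P]_w (D w)%:E = N%:E)%E.
  under eq_integral do rewrite -(dropout_series T R mu lam n _ lam0 n0).
  rewrite integral_nneseries//.
  - rewrite -NE; apply: eq_eseriesr => k _.
    rewrite ge0_integral_sum//; last first.
      by move=> j; apply/measurable_EFinP; exact: measurable_indic.
    rewrite mulr_sumr -sumEFin; apply: eq_bigr => j _.
    rewrite integral_indic// setIT; exact: probability_dropout.
  - move=> k; apply: emeasurable_sum => j.
    by apply/measurable_EFinP; exact: measurable_indic.
  - by move=> k w _; apply: sume_ge0 => j _; rewrite lee_fin.
have mK : measurable_fun setT (fun w => (K w)%:R : R).
  by apply: (measurable_fun_Kstop _ _ _ _ _ _ (fun k _ => k%:R)).
have mM : measurable_fun setT M.
  by apply: (measurable_fun_Kstop _ _ _ _ _ _ (runmin mu)) => // k; exact: measurable_runmin.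
have mDD : measurable_fun setT D.
  apply: (measurable_fun_Kstop _ _ _ _ _ _
    (fun k w => \sum_(j < k) (runmin mu k w <= j%:R * lam / n%:R)%R%:R)) => // k.
  apply: measurable_sum => j.
  rewrite [X in measurable_fun _ X](_ : _ =
    \1_(runmin mu k @^-1` `]-oo, j%:R * lam / n%:R])); last first.
    apply/funext => w; rewrite indicE; congr (_%:R); congr nat_of_bool.
    by apply/idP/idP => [h1|/set_mem]; [apply/mem_set|]; rewrite /= in_itv.
  apply: measurable_indic; apply: measurable_preimageT; last exact: measurable_itv.
  exact: measurable_runmin.
pose M' w := Num.max (M w) 0.
have mM' : measurable_fun setT M' by exact: measurable_maxr.
have aeM : \forall w \ae P, 0 <= M w.
  have : P.-negligible (\bigcup_i (mu i @^-1` `]-oo, 0])).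
    apply: negligible_bigcup => i; apply/negligibleP.
      by apply: measurable_preimageT => //; exact: measurable_itv.
    by have := FE i 0; rewrite F00.
  apply: negligibleS => w /= /negP; rewrite -ltNge => /ltW.
  have [/andP[K0 _] _] := Kstop_stops T R mu lam n w lam0 n0.
  by move=> /(runmin_leP _ _ _ _ _ _ K0)[i _ mui]; exists i.
have MM' : (\int[P]_w (M w)%:E = \int[P]_w (M' w)%:E)%E.
  apply: ae_eq_integral => //; [exact/measurable_EFinP..|].
  by apply: filterS aeM => w Mw _; rewrite /M' (max_idPl Mw).
have D0 w : 0 <= D w by rewrite sumr_ge0.
have M'0 w : 0 <= M' w by rewrite le_max lexx orbT.
have hEK : (\int[P]_w (h * (K w)%:R)%:E = (h * S)%:E)%E.
  under eq_integral do rewrite EFinM.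
  rewrite ge0_integralZl ?EK//.
  - exact/measurable_EFinP.
  - by rewrite lee_fin ltW.
have hED : (\int[P]_w (h * D w)%:E = (h * N)%:E)%E.
  under eq_integral do rewrite EFinM.
  rewrite ge0_integralZl ?ED//.
  - exact/measurable_EFinP.
  - by move=> w _; rewrite lee_fin.
  - by rewrite lee_fin ltW.
have mhK : measurable_fun setT (fun w => (h * (K w)%:R)%:E).
  by apply/measurable_EFinP; exact: measurable_funM.
have mhD : measurable_fun setT (fun w => (h * D w)%:E).
  by apply/measurable_EFinP; exact: measurable_funM.
have mMe : measurable_fun setT (fun w => (M' w)%:E) by exact/measurable_EFinP.
have aeb : \forall w \ae P, M' w + h * D w <= h * (K w)%:R <= M' w + h * D w + h.
  apply: filterS aeM => w Mw; rewrite /M' (max_idPl Mw).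
  exact: runmin_Kstop_bounds.
have s0 w : 0 <= M' w + h * D w by rewrite addr_ge0// mulr_ge0// ltW.
have ms : measurable_fun setT (fun w => (M' w + h * D w)%:E).
  by apply/measurable_EFinP; apply: measurable_funD => //; exact: measurable_funM.
have Is : (\int[P]_w (M' w + h * D w)%:E = \int[P]_w (M' w)%:E + (h * N)%:E)%E.
  rewrite -hED -ge0_integralD//.
  - by move=> w _; rewrite lee_fin.
  - by move=> w _; rewrite lee_fin mulr_ge0// ltW.
have Ish : (\int[P]_w (M' w + h * D w + h)%:E =
    \int[P]_w (M' w + h * D w)%:E + h%:E)%E.
  have Ih : (\int[P]_w (cst h%:E w) = h%:E)%E.
    by rewrite integral_cst// [X in (_ * X)%E](_ : _ = 1%E) ?mule1//; exact: probability_setT.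
  rewrite -[X in (_ + X)%E]Ih -ge0_integralD//.
  - by move=> w _; rewrite lee_fin.
  - by move=> w _; rewrite lee_fin ltW.
have le1 : (\int[P]_w (M' w)%:E + (h * N)%:E <= (h * S)%:E)%E.
  rewrite -Is -hEK; apply: ae_ge0_le_integral => //.
  - by move=> w _; rewrite lee_fin.
  - by move=> w _; rewrite lee_fin mulr_ge0// ltW.
  - by apply: filterS aeb => w /andP[h1 _] _; rewrite lee_fin.
have le2 : ((h * S)%:E <= \int[P]_w (M' w)%:E + (h * N)%:E + h%:E)%E.
  rewrite -Is -Ish -hEK; apply: ae_ge0_le_integral => //.
  - by move=> w _; rewrite lee_fin mulr_ge0// ltW.
  - by move=> w _; rewrite lee_fin addr_ge0// ltW.
  - by under eq_fun do rewrite EFinD; exact: emeasurable_funD.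
  - by apply: filterS aeb => w /andP[_ h1] _; rewrite lee_fin.
have M'fin : (\int[P]_w (M' w)%:E \is a fin_num)%E.
  rewrite ge0_fin_numE; last by apply: integral_ge0 => w _; rewrite lee_fin.
  apply: (@le_lt_trans _ _ (h * S - h * N)%:E); last exact: ltry.
  by rewrite EFinB leeBrDr.
move: le1 le2; rewrite /regret EK MM' -(fineK M'fin).
move: (fine _) => x; rewrite -!EFinM -!EFinD !lee_fin => le1 le2.
have lamE : lam = n%:R * h by rewrite /h mulrC divfK// gt_eqF.
have e1 : n%:R * x + lam * N <= lam * S.
  by have := le1; rewrite -(ler_pM2l nR) mulrDr !(mulrA n%:R h) -lamE.
have e2 : lam * S <= n%:R * x + lam * N + lam.
  by have := le2; rewrite -(ler_pM2l nR) !mulrDr !(mulrA n%:R h) -lamE.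
by apply/andP; split; lra.
Qed.

Lemma Gamma_invD1_gt0 (R : realType) (p : R) : 1 <= p -> 0 < Gamma (1 + p^-1).
Proof.
move=> p1; have [GE _] := GammaE R p p1.
rewrite -lte_fin -GE.
have mexp : measurable_fun setT (fun x : R => expR (- x `^ p)).
  by apply: measurableT_comp => //; apply: measurableT_comp => //; exact: measurable_powR.
have mI : measurable (`]0%R, 1%R] : set R) by exact: measurable_itv.
apply: (@lt_le_trans _ _ (\int[lebesgue_measure]_(t in `]0%R, 1%R]) (cst (expR (-1))%:E t))%E).
  rewrite integral_cst; last exact: mI.
  rewrite [X in (_ * X)%E](_ : _ = 1%E).
    by rewrite mule1 lte_fin expR_gt0.
  by rewrite [LHS]lebesgue_measure_itv/= lte_fin ltr01 oppr0 adde0.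
apply: (@le_trans _ _ (\int[lebesgue_measure]_(t in `]0%R, 1%R]) (expR (- t `^ p))%:E)%E).
  apply: ge0_le_integral; [exact: mI| | | |].
  - by move=> t _; rewrite lee_fin expR_ge0.
  - exact: measurable_cst.
  - by apply/measurable_EFinP; exact: measurable_funTS.
  - move=> t; rewrite /= in_itv/= => /andP[t0 t1]; rewrite lee_fin ler_expR lerN2.
    have := @ge0_ler_powR R p _ t 1; rewrite powR1; apply; rewrite ?nnegrE ?(ltW t0)//.
    exact: le_trans p1.
apply: ge0_subset_integral => //.
- by apply/measurable_EFinP; exact: measurable_funTS.
- by move=> t; rewrite /= !in_itv/= => /andP[->].
Qed.

Lemma fine_cvg_scaled (R : realType) (a : nat -> \bar R) (m : nat -> R) (l : R) :
  (forall n, 0 < m n) -> (a n * ((m n)^-1)%:E)%E @[n --> \oo] --> l%:E ->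
  (\forall n \near \oo, a n = (fine (a n))%:E) /\
  fine (a n) / m n @[n --> \oo] --> l.
Proof.
move=> m0 /fine_cvgP[afin ca].
have afin' : \forall n \near \oo, a n \is a fin_num.
  near=> n; have : (a n * ((m n)^-1)%:E)%E \is a fin_num by near: n.
  have mV : 0 < (m n)^-1 by rewrite invr_gt0.
  case: (a n) => [r| |]//.
    by rewrite gt0_mulye ?lte_fin.
  by rewrite gt0_mulNye ?lte_fin.
split; first by near=> n; rewrite fineK//; near: n.
apply: cvg_trans ca; apply: near_eq_cvg; near=> n.
by rewrite /= fineM//; near: n.
Unshelve. all: by end_near. Qed.

Theorem theorem2 (R : realType) (d : measure_display) (T : measurableType d)
  (P : probability T R) (g : R -> R) (alpha beta lam : R) (mu : nat -> T -> R) :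
  0 < alpha -> 0 < beta -> 0 < lam ->
  (* g is a probability density on (0, oo) *)
  measurable_fun (`]0%R, +oo[ : set R) g ->
  (forall x, 0 < x -> 0 <= g x) ->
  (\int[@lebesgue_measure R]_(x in (`]0%R, +oo[ : set R)) (g x)%:E = 1)%E ->
  (* g(x) ~ alpha x^(beta-1) as x -> 0+ *)
  g x / (alpha * x `^ (beta - 1)) @[x --> (0:R)^'+] --> (1:R) ->
  (* mu_1, mu_2, ... are i.i.d. with density g *)
  (forall k, measurable_fun setT (mu k)) ->
  (forall k (A : set R), measurable A ->
     P (mu k @^-1` A) =
     (\int[@lebesgue_measure R]_(x in A `&` (`]0%R, +oo[ : set R)) (g x)%:E)%E) ->
  mutually_independent P mu ->
  let C := (lam * beta * (beta + 1) / alpha) `^ (1 / (beta + 1)) in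
  let I := (1 / (beta + 1)) `^ (1 / (beta + 1)) * (2 - 1 / (beta + 1) ^+ 2)
           * Gamma (2 - beta / (beta + 1)) in
  (fun n : nat => (regret P mu lam n * ((C * I * n%:R `^ (beta / (beta + 1)))^-1)%:E)%E)
    @ \oo --> 1%E.
Proof.
move=> a0 b0 lam0 mg g0 g1 gc mmu mulaw ind C I.
suff key : (regret P mu lam n.+1 *
    ((C * I * n.+1%:R `^ (beta / (beta + 1)))^-1)%:E)%E @[n --> \oo] --> 1%E.
  by rewrite -cvg_shiftS.
have p0 : 0 < beta + 1 by lra.
have p1 : 1 <= beta + 1 by lra.
pose A := alpha / beta; have A0 : 0 < A by rewrite divr_gt0.
pose F x := fine (P (mu 0%N @^-1` `]-oo, x])).
have mle (x : R) : measurable (mu 0%N @^-1` `]-oo, x]).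
  by apply: measurable_preimageT => //; exact: measurable_itv.
have F0E x : P (mu 0%N @^-1` `]-oo, x]) = (F x)%:E.
  by rewrite /F fineK// fin_num_measure.
have FE i x : P (mu i @^-1` `]-oo, x]) = (F x)%:E.
  by rewrite -F0E !mulaw//; exact: measurable_itv.
have Fnd : {homo F : x y / x <= y}.
  move=> x y xy; rewrite -lee_fin -!F0E; apply: le_measure; rewrite ?inE//.
  by move=> w /=; rewrite !in_itv/= => /le_trans; apply.
have F01 x : 0 <= F x <= 1.
  by rewrite -!lee_fin -F0E probability_le1// measure_ge0.
have FI x : F x = fine (\int[lebesgue_measure]_(t in `]0%R, x]) (g t)%:E)%E.
  rewrite /F mulaw; last exact: measurable_itv.
  congr (fine (integral _ _ _)); apply/seteqP; split => t /=; rewrite !in_itv/= andbT.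
    by move=> [-> ->].
  by move=> /andP[].
have F00 : F 0 = 0 by rewrite FI set_itvoc0 integral_set0.
have FA : F x / x `^ beta @[x --> 0^'+] --> A.
  under eq_cvg do rewrite FI.
  exact: cvg_integral_density_powR.
pose del n := lam / n.+1%:R; have del0 n : 0 < del n by rewrite divr_gt0.
pose rho n := (del n / A) `^ (beta + 1)^-1.
have rho0 n : 0 < rho n by rewrite powR_gt0// divr_gt0.
pose m n := (A * rho n `^ beta)^-1.
have m0 n : 0 < m n by rewrite invr_gt0 mulr_gt0// powR_gt0.
have crho : rho n @[n --> \oo] --> (0 : R).
  have cdel : del n / A @[n --> \oo] --> (0 : R).
    have : lam / A * harmonic n @[n --> \oo] --> lam / A * 0.
      by apply: cvgMl_tmp; exact: cvg_harmonic.
    rewrite mulr0; apply: cvg_trans; apply: near_eq_cvg; apply: nearW => n.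
    by rewrite /del /harmonic mulrAC.
  have c1 : 1 * (del n / A) `^ (beta + 1)^-1 @[n --> \oo] --> (0 : R).
    by apply: cvg_powR_scale0; rewrite ?invr_gt0// => n; rewrite divr_gt0.
  by apply: cvg_trans c1; apply: near_eq_cvg; apply: nearW => n; rewrite /= mul1r.
have rhoE n : A * rho n `^ beta * rho n = del n.
  rewrite -mulrA -[X in _ * (_ * X)](powRr1 (ltW (rho0 n))) -powRD; last first.
    by rewrite gt_eqF// implybT.
  by rewrite /rho -powRrM mulVf ?gt_eqF// powRr1 ?divr_ge0 ?ltW// mulrC divfK// gt_eqF.
have stepE n k : rho n * (k%:R / m n) = k%:R * lam / n.+1%:R.
  rewrite /m invrK; transitivity (k%:R * (A * rho n `^ beta * rho n)); first by ring.
  by rewrite rhoE /del mulrA.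
have [cS cN] := cvg_scaled_series R F A beta rho m A0 b0 Fnd F01 F00 FA rho0 crho (fun=> erefl).
set G := Gamma _ in cS cN.
have G0 : 0 < G by exact: Gamma_invD1_gt0.
pose Ss n := (\sum_(k <oo) ((1 - F (k%:R * lam / n.+1%:R)) ^+ k)%:E)%E.
pose Ns n := (\sum_(k <oo) ((1 - F (k%:R * lam / n.+1%:R)) ^+ k *
     \sum_(j < k.+1) F (j%:R * lam / n.+1%:R))%:E)%E.
have {}cS : (Ss n * ((m n)^-1)%:E)%E @[n --> \oo] --> G%:E.
  apply: cvg_trans cS; apply: near_eq_cvg; apply: nearW => n; congr (_ * _)%E.
  by apply: eq_eseriesr => k _; rewrite stepE.
have {}cN : (Ns n * ((m n)^-1)%:E)%E @[n --> \oo] --> (G / (beta + 1) ^+ 2)%:E.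
  apply: cvg_trans cN; apply: near_eq_cvg; apply: nearW => n; congr (_ * _)%E.
  by apply: eq_eseriesr => k _; rewrite stepE; under eq_bigr do rewrite stepE.
have [SE {}cS] := fine_cvg_scaled R Ss m G m0 cS.
have [NE {}cN] := fine_cvg_scaled R Ns m _ m0 cN.
pose c := (2 - 1 / (beta + 1) ^+ 2) * G.
have c0 : 0 < c.
  rewrite mulr_gt0// subr_gt0 ltr_pdivrMr ?exprn_gt0//.
  have : 1 <= (beta + 1) ^+ 2 by rewrite exprn_ege1.
  by lra.
have DE n : C * I * n.+1%:R `^ (beta / (beta + 1)) = lam * m n * c.
  have -> : C * I = (lam / A) `^ (beta + 1)^-1 * c.
    rewrite /C /I /c /G !div1r mulrA mulrA -powRM ?invr_ge0 ?(ltW p0)//; last first.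
      by apply/ltW; apply: divr_gt0 => //; apply: mulr_gt0 => //; exact: mulr_gt0.
    rewrite -mulrA; congr (_ `^ _ * (_ * Gamma _)).
      by rewrite /A; field; rewrite !gt_eqF.
    by field; rewrite gt_eqF.
  have -> : lam * m n = rho n * n.+1%:R.
    have mE : m n = rho n / del n.
      by rewrite -rhoE invfM mulrCA mulfV ?mulr1// gt_eqF.
    by rewrite mE /del invf_div mulrCA [lam * _]mulrC divfK// gt_eqF.
  rewrite mulrAC; congr (_ * _); rewrite /rho /del.
  have -> : lam / n.+1%:R / A = lam / A * (n.+1%:R)^-1 by rewrite mulrAC.
  have : 0 <= lam / A by rewrite ltW// divr_gt0.
  move: (lam / A) => q q0; rewrite powRM ?invr_ge0// -mulrA; congr (_ * _).
  rewrite -[n.+1%:R^-1]powR_inv1// -powRrM -[X in _ = _ * X](@powRr1 _ n.+1%:R)//.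
  rewrite -powRD; last by rewrite pnatr_eq0 implybT.
  by congr (_ `^ _); field; rewrite gt_eqF.
have cmV : (m n)^-1 @[n --> \oo] --> (0 : R).
  by under eq_cvg do rewrite invrK; exact: cvg_powR_scale0.
pose s n := fine (Ss n) / m n; pose t n := fine (Ns n) / m n.
have cu : (2 * s n - t n) / c @[n --> \oo] --> (1 : R).
  have : (2 * s n - t n) / c @[n --> \oo] --> (2 * G - G / (beta + 1) ^+ 2) / c.
    by apply: cvgMr_tmp; apply: cvgB => //; exact: cvgMl_tmp.
  have -> // : (2 * G - G / (beta + 1) ^+ 2) / c = 1.
  rewrite [X in X / _](_ : _ = c) ?divff ?gt_eqF//.
  by rewrite /c mulrBl div1r [_^-1 * _]mulrC.
have cl : (2 * s n - t n) / c - (m n)^-1 / c @[n --> \oo] --> (1 : R).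
  have : (2 * s n - t n) / c - (m n)^-1 / c @[n --> \oo] --> 1 - 0 / c.
    by apply: cvgB => //; exact: cvgMr_tmp.
  by rewrite mul0r subr0.
apply: (@squeeze_cvge _ _ _ _ (fun n => ((2 * s n - t n) / c - (m n)^-1 / c)%:E) _
  (fun n => ((2 * s n - t n) / c)%:E)); last 2 first.
- by apply: cvg_EFin => //; exact: nearW.
- by apply: cvg_EFin => //; exact: nearW.
near=> n.
have SEn : Ss n = (fine (Ss n))%:E by near: n.
have NEn : Ns n = (fine (Ns n))%:E by near: n.
have /andP[rl ru] := regret_bounds _ _ _ P mu F lam n.+1 _ _ lam0 (ltn0Sn n) mmu FE F00 ind SEn NEn.
rewrite DE.
have D0 : 0 < lam * m n * c by apply: mulr_gt0 => //; exact: mulr_gt0.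
have DV0 : (0 <= ((lam * m n * c)^-1)%:E)%E by rewrite lee_fin invr_ge0 ltW.
apply/andP; split.
  apply: le_trans (lee_wpmul2r DV0 rl); rewrite -EFinM lee_fin.
  rewrite le_eqVlt; apply/orP; left; apply/eqP; rewrite /s /t; field.
  by rewrite !gt_eqF.
apply: (le_trans (lee_wpmul2r DV0 ru)); rewrite -EFinM lee_fin.
rewrite le_eqVlt; apply/orP; left; apply/eqP; rewrite /s /t; field.
by rewrite !gt_eqF.
Unshelve. all: by end_near. Qed.
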